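(* There is an algorithm which, given any symmetric fair division instance with $n$ agents having $\mathsf{SPLC}$ valuations (specified by the number of types $t$, the numbers of copies $(k_j)_{j\in[t]}$ and the values $v_{ijk}$), outputs in polynomial time an allocation $(A_1,\dots,A_n)$ of the goods such that $v_i(A_i)\ge \frac12 \mathsf{APS}_i$ for every agent $i\in[n]$, where $\mathsf{APS}_i$ is the any price share of agent $i$ with entitlement $b_i=\frac1n$.
   Context: $\mathsf{SPLC}$ (separable piecewise-linear concave) valuations: there are $t$ types of goods, type $j\in[t]$ having $k_j$ identical copies; $\mathcal M$ is the set of all copies of all goods and $\mathcal M_j\subseteq\mathcal M$ is the set of copies of good $j$. Agent $i$ has values $v_{ij1}\ge v_{ij2}\ge\dots\ge v_{ijk_j}\ge 0$ for each $j\in[t]$, and $v_i(S)=\sum_{j\in[t]}\sum_{k\le |S\cap\mathcal M_j|}v_{ijk}$ for $S\subseteq\mathcal M$. An allocation is a partition $(A_1,\dots,A_n)$ of $\mathcal M$ (empty parts allowed). The any price share of an agent with valuation $v_i$ and entitlement $b_i$ is $\mathsf{APS}_i=\min_{p}\ \max_{S\subseteq\mathcal M:\ \sum_{g\in S}p_g\le b_i}v_i(S)$, where the minimum is over all price vectors $p=(p_g)_{g\in\mathcal M}$ with $p_g\ge 0$ and $\sum_{g\in\mathcal M}p_g=1$. *)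

(* Defs.v *)
From HB Require Import structures.
From mathcomp Require Import all_boot all_order all_algebra.
From mathcomp Require Import all_classical reals.

Set Implicit Arguments.
Unset Strict Implicit.
Unset Printing Implicit Defensive.
Import Order.TTheory GRing.Theory Num.Theory.
Local Open Scope ring_scope.

(** Copies of a good are numbered from 0, so that [value i j k] is the
    value of the (k+1)-st copy.  Values are rational, so that an instance is a finite input. *)
Record instance := Instance {
  agents : nat;
  types : nat;
  copies : 'I_types -> nat;
  value : 'I_agents -> forall j : 'I_types, 'I_(copies j) -> rat;
  agents_gt0 : (0 < agents)%N;
  value_ge0 : forall i j k, 0 <= value i (j := j) k;
  value_noninc : forall i j (k l : 'I_(copies j)),
    (k <= l)%N -> value i l <= value i k
}.

Definition good (I : instance) : finType :=
  {j : 'I_(types I) & 'I_(copies j)}.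

Definition copies_of (I : instance) (j : 'I_(types I)) : {set good I} :=
  [set g | tag g == j]%SET.

Definition valuation (I : instance) (i : 'I_(agents I)) (S : {set good I}) :
    rat :=
  \sum_(j < types I) \sum_(k < copies j | (k < #|S :&: copies_of j|)%N)
    value i k.

Definition is_allocation (I : instance)
    (A : 'I_(agents I) -> {set good I}) : Prop :=
  (forall i j, i != j -> [disjoint A i & A j])
  /\ (\bigcup_(i < agents I) A i)%SET = [set: good I]%SET.

Definition price_vector (R : realType) (I : instance) (p : good I -> R) : Prop :=
  (forall g, 0 <= p g) /\ \sum_g p g = 1.

(** The default value 0 of the maximum is harmless: valuations are nonnegative
    and, for [0 <= b], the empty bundle is affordable. *)
Definition best_affordable (R : realType) (I : instance) (i : 'I_(agents I))
    (b : R) (p : good I -> R) : rat :=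
  \big[Num.max/0]_(S : {set good I} | \sum_(g in S) p g <= b) valuation i S.

(** The infimum is a minimum as soon as there is a good ([APS_attained] below);
    without goods there is no price vector and [APS] is 0. *)
Definition APS (R : realType) (I : instance) (i : 'I_(agents I)) (b : R) : R :=
  inf [set ratr (best_affordable i b p) | p in @price_vector R I]%classic.

(** Programs run on a random access machine with logarithmic cost, whose
    running time is polynomially related to that of Turing machines.
    A memory consists of integer arrays named by natural numbers; a program
    only mentions finitely many of them.  Cells are addressed by integers, and
    addresses may be computed. *)
Definition memory := nat -> int -> int.

Inductive binop := Add | Sub | Mul | Quo | Leq.

Definition eval_op (o : binop) (x y : int) : int :=
  match o with
  | Add => x + y
  | Sub => x - y
  | Mul => x * y
  | Quo => (x %/ y)%Z
  | Leq => if x <= y then 1 else 0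
  end.

Inductive expr :=
  | Cst of int
  | Get of nat & expr
  | Op of binop & expr & expr.

Fixpoint eval (m : memory) (e : expr) : int :=
  match e with
  | Cst z => z
  | Get a e1 => m a (eval m e1)
  | Op o e1 e2 => eval_op o (eval m e1) (eval m e2)
  end.

(** Number of binary digits of the absolute value; [bits 0 = 1]. *)
Definition bits (z : int) : nat := (trunc_log 2 `|z|%N).+1.

(** Every intermediate result, addresses included, is charged its length. *)
Fixpoint eval_cost (m : memory) (e : expr) : nat :=
  (bits (eval m e) +
   match e with
   | Cst _ => 0
   | Get _ e1 => eval_cost m e1
   | Op _ e1 e2 => eval_cost m e1 + eval_cost m e2
   end)%N.

Inductive program :=
  | Skip
  | Assign of nat & expr & expr
  | Seq of program & program
  | If of expr & program & program
  | While of expr & program.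

Definition update (m : memory) (a : nat) (x y : int) : memory :=
  fun a' x' => if (a' == a) && (x' == x) then y else m a' x'.

(** [exec m P k m']: started in [m], the program [P] halts in [m'] after
    time [k]. *)
Inductive exec : memory -> program -> nat -> memory -> Prop :=
  | exec_skip m : exec m Skip 1 m
  | exec_assign m a e1 e2 :
      exec m (Assign a e1 e2) (eval_cost m e1 + eval_cost m e2)
        (update m a (eval m e1) (eval m e2))
  | exec_seq m m1 m2 P1 P2 k1 k2 :
      exec m P1 k1 m1 -> exec m1 P2 k2 m2 ->
      exec m (Seq P1 P2) (k1 + k2) m2
  | exec_if_true m m1 e P1 P2 k :
      eval m e != 0 -> exec m P1 k m1 ->
      exec m (If e P1 P2) (eval_cost m e + k) m1
  | exec_if_false m m1 e P1 P2 k :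
      eval m e = 0 -> exec m P2 k m1 ->
      exec m (If e P1 P2) (eval_cost m e + k) m1
  | exec_while_true m m1 m2 e P k1 k2 :
      eval m e != 0 -> exec m P k1 m1 -> exec m1 (While e P) k2 m2 ->
      exec m (While e P) (eval_cost m e + k1 + k2) m2
  | exec_while_false m e P :
      eval m e = 0 -> exec m (While e P) (eval_cost m e) m.

Definition goods (I : instance) : seq (good I) :=
  [seq Tagged (fun j => 'I_(copies j)) k
     | j <- enum 'I_(types I), k <- enum 'I_(copies j)].

(** The number of agents, the number of types, the numbers of copies, and then
    agent by agent the numerators and denominators of the values. *)
Definition input (I : instance) : seq int :=
  [:: (agents I)%:Z; (types I)%:Z]
  ++ [seq (copies j)%:Z | j <- enum 'I_(types I)]
  ++ flatten [seq let q := value i (tagged g) in [:: numq q; denq q]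
                | i <- enum 'I_(agents I), g <- goods I].

Definition input_size (I : instance) : nat := \sum_(z <- input I) bits z.

(** Array 0 initially holds the input; all other cells are 0. *)
Definition initial_memory (I : instance) : memory :=
  fun a x => match a, x with
             | 0%N, Posz k => nth 0 (input I) k
             | _, _ => 0
             end.

(** On halting, array 1 holds the owners (numbered from 0) of the goods, in the
    order of [goods I]. *)
Definition outputs (I : instance) (m : memory)
    (A : 'I_(agents I) -> {set good I}) : Prop :=
  forall i g, (g \in A i) = (m 1%N (index g (goods I)) == i%:Z).

Lemma exec_det m P k k' m1 m2 :
  exec m P k m1 -> exec m P k' m2 -> k = k' /\ m1 = m2.
Proof.
move=> H; elim: H k' m2 => {m P k m1}.
- by move=> m k' m2 H; inversion H.
- by move=> m a e1 e2 k' m2 H; inversion H.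
- move=> m m1 m2 P1 P2 k1 k2 _ IH1 _ IH2 k' m' H.
  inversion H as [| |? ? ? ? ? ? ? H1 H2| | | |]; subst.
  by case: (IH1 _ _ H1) H2 => -> <- /IH2 [-> ->].
- move=> m m1 e P1 P2 k He _ IH k' m' H.
  inversion H as [| | |? ? ? ? ? ? He' H1|? ? ? ? ? ? He' H1| |]; subst.
    by case: (IH _ _ H1) => -> ->.
  by rewrite He' eqxx in He.
- move=> m m1 e P1 P2 k He _ IH k' m' H.
  inversion H as [| | |? ? ? ? ? ? He' H1|? ? ? ? ? ? He' H1| |]; subst.
    by rewrite He eqxx in He'.
  by case: (IH _ _ H1) => -> ->.
- move=> m m1 m2 e P k1 k2 He _ IH1 _ IH2 k' m' H.
  inversion H as [| | | | |? ? ? ? ? ? ? He' H1 H2|? ? ? He']; subst.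
    by case: (IH1 _ _ H1) H2 => -> <- /IH2 [-> ->].
  by rewrite He' eqxx in He.
- move=> m e P He k' m' H.
  inversion H as [| | | | |? ? ? ? ? ? ? He' H1 H2|? ? ? He']; subst => //.
  by rewrite He eqxx in He'.
Qed.

Lemma mem_goods (I : instance) (g : good I) : g \in goods I.
Proof.
case: g => j k; apply/allpairsPdep; exists j, k.
by rewrite !mem_enum.
Qed.

Lemma uniq_goods (I : instance) : uniq (goods I).
Proof.
apply: allpairs_uniq_dep => [|j _|[j k] [j' k'] _ _ //]; exact: enum_uniq.
Qed.

Lemma APS_attained (R : realType) (I : instance) (i : 'I_(agents I)) (b : R) :
  (0 < #|good I|)%N ->
  exists p : good I -> R, [/\ price_vector p,
    APS i b = ratr (best_affordable i b p) &
    forall p', price_vector p' ->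
      best_affordable i b p <= best_affordable i b p'].
Proof.
move=> G_gt0.
pose affordable (p : good I -> R) : {set {set good I}} :=
  [set S : {set good I} | \sum_(g in S) p g <= b]%SET.
pose best (F : {set {set good I}}) : rat :=
  \big[Num.max/0]_(S in F) valuation i S.
have bestE p : best_affordable i b p = best (affordable p).
  by apply: eq_bigl => S; rewrite inE.
pose Q F := `[< exists2 p, price_vector p & affordable p = F >].
pose u (g : good I) : R := #|good I|%:R^-1.
have Qu : Q (affordable u).
  apply/asboolP; exists u => //; split=> [g|].
    by rewrite invr_ge0 ler0n.
  by rewrite sumr_const -[_ *+ _]mulr_natr mulVf // pnatr_eq0 -lt0n.
case: (@Order.TotalTheory.arg_minP _ _ _ _ Q best Qu) => F /asboolP[p pP <-] minF.
have minp p' : price_vector p' ->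
    best_affordable i b p <= best_affordable i b p'.
  by move=> p'P; rewrite !bestE; apply: minF; apply/asboolP; exists p'.
exists p; split=> //; apply/eqP; rewrite eq_le; apply/andP; split.
  apply: ge_inf; last by exists p.
  by exists (ratr (best_affordable i b p)) => _ [p' p'P <-]; rewrite ler_rat minp.
apply: lb_le_inf; first by exists (ratr (best_affordable i b p)); exists p.
by move=> _ [p' p'P <-]; rewrite ler_rat minp.
Qed.

(* Main.v *)
(** For an agent with entitlement [1/n], interpolate the value of each type
    linearly between integers and let [F] be the value of [1/n] of all copies of
    every type.  Supporting slopes of the interpolation, used as prices, show
    that the any price share is at most [F]; pricing some goods slightly above
    the budget shows the same for the instance in which [n - r] goods have been
    removed and [r] agents are left.

    With [r] agents left, give a single copy to an agent who values it at
    [F / 2] or more, if there is one.  Otherwise start from the bundle with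
    [rem / r] copies of each type, rounded down, and round up one type after
    the other until a remaining agent values the bundle at [F / 2] or more.
    Both the bundle and the average of what it leaves to the [r - 1] others stay
    within one linear piece of every interpolation, so [F] does not decrease
    for an agent who values the bundle at most [F]; this holds for all of them,
    as before the last increment the value was below [F / 2] and no single copy
    is worth [F / 2].

    In the program every assigned expression is of degree at most 1 in the
    mutable memory, so the bit lengths grow linearly with the number of steps,
    and this number is polynomial because all loop bounds are fixed in advance. *)

Require Import Defs.
From mathcomp Require Import all_boot all_order all_algebra.
From mathcomp Require classical_sets.
From mathcomp Require Import reals.
From mathcomp Require Import zify ring lra.
Set Implicit Arguments.
Unset Strict Implicit.
Unset Printing Implicit Defensive.
Import Order.TTheory GRing.Theory Num.Theory.
Local Open Scope ring_scope.

(** * Programs with bounded loops *)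

Inductive cmd :=
  | CAssign of nat & expr & expr
  | CSeq of cmd & cmd
  | CIf of expr & cmd
  | CFor of nat & expr & cmd.

Definition var (x : nat) : expr := Get x (Cst 0).
Definition assign (x : nat) (e : expr) : cmd := CAssign x (Cst 0) e.

(* Loops count down to 0, so that the bound is evaluated only once. *)
Fixpoint compile (c : cmd) : program :=
  match c with
  | CAssign a e1 e2 => Assign a e1 e2
  | CSeq c1 c2 => Seq (compile c1) (compile c2)
  | CIf e c => If e (compile c) Skip
  | CFor x e c =>
      Seq (Assign x (Cst 0) e)
          (While (Op Leq (Cst 1) (var x))
             (Seq (Assign x (Cst 0) (Op Defs.Sub (var x) (Cst 1))) (compile c)))
  end.

(** The counter is stored before each pass, so the body sees [n - 1, ..., 0]. *)
Fixpoint iter_down (x : nat) (f : memory -> memory) (n : nat) (m : memory) :=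
  if n is k.+1 then iter_down x f k (f (update m x 0 k%:Z)) else m.

(** A negative bound gives no pass, in agreement with the test of the compiled loop. *)
Definition trips (m : memory) (e : expr) : nat :=
  if eval m e is Posz n then n else 0%N.

Fixpoint denote (c : cmd) (m : memory) : memory :=
  match c with
  | CAssign a e1 e2 => update m a (eval m e1) (eval m e2)
  | CSeq c1 c2 => denote c2 (denote c1 m)
  | CIf e c => if eval m e != 0 then denote c m else m
  | CFor x e c => iter_down x (denote c) (trips m e) (update m x 0 (eval m e))
  end.

Fixpoint writes (c : cmd) : seq nat :=
  match c with
  | CAssign a _ _ => [:: a]
  | CSeq c1 c2 => writes c1 ++ writes c2
  | CIf _ c => writes c
  | CFor x _ c => x :: writes c
  end.

Definition eqoff (W : seq nat) (m m' : memory) : Prop :=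
  forall a, a \notin W -> m' a = m a.

Lemma eqoff_trans W m1 m2 m3 :
  eqoff W m1 m2 -> eqoff W m2 m3 -> eqoff W m1 m3.
Proof. by move=> h1 h2 a aW; rewrite h2 // h1. Qed.

Lemma eqoff_sub (W W' : seq nat) m m' :
  {subset W <= W'} -> eqoff W m m' -> eqoff W' m m'.
Proof. by move=> sW h a aW; apply: h; apply: contra aW; apply: sW. Qed.

Lemma update_eq m a x y : update m a x y a x = y.
Proof. by rewrite /update !eqxx. Qed.

Lemma eqoff_update (W : seq nat) m a x y : a \in W -> eqoff W m (update m a x y).
Proof.
move=> aW a' a'W; rewrite /update; case: eqP => // aa; by rewrite aa aW in a'W.
Qed.

(** The invariant is indexed by the number of passes still to run, so it descends to 0. *)
Lemma iter_down_ind x f (Q : nat -> memory -> Prop) n m :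
  Q n m ->
  (forall i m', (i < n)%N -> Q i.+1 m' -> Q i (f (update m' x 0 i%:Z))) ->
  Q 0%N (iter_down x f n m).
Proof.
elim: n m => //= n IH m Qn Hs; apply: IH; first by apply: Hs.
by move=> i m' lin; apply: Hs; rewrite ltnS ltnW.
Qed.

Lemma denote_frame c m : eqoff (writes c) m (denote c m).
Proof.
elim: c m => [a e1 e2|c1 IH1 c2 IH2|e c IH|x e c IH] m /=.
- by apply: eqoff_update; rewrite inE.
- apply: (@eqoff_trans _ _ (denote c1 m)).
    by apply: eqoff_sub (IH1 m) => a; rewrite mem_cat => ->.
  by apply: eqoff_sub (IH2 _) => a; rewrite mem_cat orbC => ->.
- by case: ifP.
- apply: (@iter_down_ind x (denote c) (fun _ m' => eqoff (x :: writes c) m m')).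
    by apply: eqoff_update; rewrite inE eqxx.
  move=> i m' _ h; apply: eqoff_trans h _.
  apply: eqoff_trans (eqoff_update _ _ _ (mem_head _ _)) _.
  by apply: eqoff_sub (IH _) => a; rewrite inE orbC => ->.
Qed.

Arguments denote_frame : clear implicits.

Fixpoint arrays (e : expr) : seq nat :=
  match e with
  | Cst _ => [::]
  | Get a e => a :: arrays e
  | Op _ e1 e2 => arrays e1 ++ arrays e2
  end.

Lemma eval_eqoff W m m' e :
  eqoff W m m' -> all (fun a => a \notin W) (arrays e) -> eval m' e = eval m e.
Proof.
move=> h; elim: e => [//|a e IH|o e1 IH1 e2 IH2] /=.
  by case/andP=> aW /IH ->; rewrite h.
by rewrite all_cat => /andP[/IH1 -> /IH2 ->].
Qed.

Fixpoint weight (e : expr) : nat :=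
  match e with
  | Cst z => `|z|%N.+1
  | Get _ e => (weight e).+1
  | Op _ e1 e2 => (weight e1 + weight e2).+1
  end.

(* Degree of an expression in the contents of the arrays other than the
   input: the input array 0 is never written, so its entries trips as constants. *)
Fixpoint degree (e : expr) : nat :=
  match e with
  | Cst _ => 0
  | Get a _ => (a != 0)%N
  | Op Add e1 e2 | Op Defs.Sub e1 e2 => maxn (degree e1) (degree e2)
  | Op Mul e1 e2 => degree e1 + degree e2
  | Op Quo e1 _ => degree e1
  | Op Leq _ _ => 0
  end.

(* Assigning only expressions of degree at most 1 lets the bit lengths grow
   linearly in the number of steps. *)
Fixpoint linear_growth (E : nat) (c : cmd) : bool :=
  match c with
  | CAssign a e1 e2 =>
      [&& a != 0%N, degree e2 <= 1, weight e1 <= E & weight e2 <= E]%N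
  | CSeq c1 c2 => linear_growth E c1 && linear_growth E c2
  | CIf e c => (weight e <= E)%N && linear_growth E c
  | CFor x e c =>
      [&& x != 0%N, x \notin writes c, degree e <= 1, weight e <= E & linear_growth E c]%N
  end.

(** [W] is meant to contain all written arrays: bounds that avoid [W] keep their values throughout,
    so they can be checked once, in the memory before the run. *)
Fixpoint loops_within (Q : nat) (W : seq nat) (m : memory) (c : cmd) : Prop :=
  match c with
  | CAssign _ _ _ => True
  | CSeq c1 c2 => loops_within Q W m c1 /\ loops_within Q W m c2
  | CIf _ c => loops_within Q W m c
  | CFor _ e c =>
      [/\ all (fun a => a \notin W) (arrays e), (trips m e <= Q)%N &
          loops_within Q W m c]
  end.

Lemma loops_within_eqoff Q W m m' c :
  eqoff W m m' -> loops_within Q W m c -> loops_within Q W m' c.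
Proof.
move=> h; elim: c => [a e1 e2|c1 IH1 c2 IH2|e c IH|x e c IH] //=.
  by case=> /IH1 ? /IH2.
by case=> eW cQ /IH; split=> //; rewrite /trips (eval_eqoff h eW).
Qed.

(** A loop pays two extra steps per pass, for the test and the decrement, and two more for the
    initial store and the failing test. *)
Fixpoint steps (Q : nat) (c : cmd) : nat :=
  match c with
  | CAssign _ _ _ => 1
  | CSeq c1 c2 => steps Q c1 + steps Q c2
  | CIf _ c => (steps Q c).+2
  | CFor _ _ c => (Q * (steps Q c).+2).+2
  end.

(** * Bit lengths and running time of compiled commands *)

Section Cost.
Variables (s E : nat).
Hypotheses (s_gt0 : (0 < s)%N) (E_ge : (8 <= E)%N).

(** Array 0 has its own bound, as it is never written; only the bound [N] for the others grows
    during a run. *)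
Definition bounded (N : nat) (m : memory) : Prop :=
  forall a x, (`|m a x| <= 2 ^ (if a == 0%N then s else N))%N.

(** A product adds bit lengths, which the degree accounts for. A sum has one bit more than its
    longer term, and the extra [s > 0] brought by each node pays for it. *)
Lemma leq_absz_eval N m e : bounded N m ->
  (`|eval m e| <= 2 ^ (weight e * s + degree e * N))%N.
Proof.
move=> Hm.
have p2 a b : (a <= b -> 2 ^ a <= 2 ^ b)%N by move=> ?; rewrite leq_exp2l.
elim: e => [z|a e IH|o e1 IH1 e2 IH2] /=.
- rewrite mul0n addn0; apply: leq_trans (ltnW (ltn_expl _ (ltnSn 1))) (p2 _ _ _).
  by nia.
- apply: leq_trans (Hm _ _) (p2 _ _ _); case: eqP => _ /=; nia.
set a1 := (weight e1 * s + _)%N in IH1; set a2 := (weight e2 * s + _)%N in IH2.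
have add (x y : int) : (`|x| <= 2 ^ a1 -> `|y| <= 2 ^ a2 -> `|(x + y)%R| <=
   2 ^ ((weight e1 + weight e2).+1 * s + maxn (degree e1) (degree e2) * N))%N.
  move=> hx hy; set b := (_ + maxn _ _ * N)%N.
  have b1 : (a1 < b)%N by rewrite /a1 /b; nia.
  have b2 : (a2 < b)%N by rewrite /a2 /b; nia.
  have := p2 _ _ b1; have := p2 _ _ b2; rewrite !expnS.
  by move: (2 ^ b)%N hx hy; set A := (2 ^ a1)%N; set B := (2 ^ a2)%N; lia.
case: o => /=.
- exact: add.
- by apply: add => //; rewrite abszN.
- rewrite abszM; apply: leq_trans (leq_mul IH1 IH2) _.
  by rewrite -expnD; apply: p2; rewrite /a1 /a2; nia.
- by apply: leq_trans (lez_div _ _) (leq_trans IH1 (p2 _ _ _)); rewrite /a1; nia.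
- by case: ifP => _; rewrite ?expn_gt0 //; case: (2 ^ _)%N.
Qed.


Lemma bits_le z L : (`|z| <= 2 ^ L)%N -> (bits z <= L.+1)%N.
Proof. by move=> h; rewrite /bits ltnS -(@trunc_expnK 2 L) // leq_trunc_log. Qed.

Lemma degree_le_weight e : (degree e <= weight e)%N.
Proof.
by elim: e => [z|a e IH|[] e1 IH1 e2 IH2] //=; [case: eqP => _ /=|..]; lia.
Qed.

(** There are at most [weight e] nodes, and the result of each has at most [weight e * (s + N) + 1]
    bits. *)
Lemma eval_cost_le N m e : bounded N m ->
  (eval_cost m e <= weight e * (weight e * (s + N)).+1)%N.
Proof.
move=> Hm.
have node e' : (bits (eval m e') <= (weight e' * (s + N)).+1)%N.
  apply: leq_trans (bits_le (leq_absz_eval e' Hm)) _.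
  by have := degree_le_weight e'; rewrite ltnS; nia.
elim: e => [z|a e IH|o e1 IH1 e2 IH2].
- have := node (Cst z); rewrite /= addn0 => /leq_trans; apply.
  by rewrite leq_pmull.
- apply: leq_trans (leq_add (node (Get a e)) IH) _ => /=.
  move: (weight e) (s + N)%N => w X.
  have : (0 <= w * X)%N by [].
  nia.
apply: leq_trans (leq_add (node (Op o e1 e2)) (leq_add IH1 IH2)) _ => /=.
move: (weight e1) (weight e2) (s + N)%N => a b X.
have : (0 <= X * (2 * a * b + a + b))%N by [].
nia.
Qed.

(** Twice a bound on the cost of an expression of weight at most [E], as an assignment evaluates two
    expressions. *)
Definition unit_cost (N : nat) : nat := ((E + E) * (E * (s + N)).+1).+1.

Lemma unit_cost_ge N m e : bounded N m -> (weight e <= E)%N ->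
  (2 * eval_cost m e < unit_cost N)%N.
Proof.
move=> Hm wE; rewrite /unit_cost ltnS addnn -mul2n -mulnA leq_mul2l /=.
by apply: leq_trans (eval_cost_le e Hm) _; rewrite leq_mul // ltnS leq_mul2r wE orbT.
Qed.

Lemma unit_cost_mono N N' : (N <= N')%N -> (unit_cost N <= unit_cost N')%N.
Proof. by move=> h; rewrite /unit_cost; nia. Qed.

Lemma bounded_mono N N' m : (N <= N')%N -> bounded N m -> bounded N' m.
Proof.
move=> h Hm a x; apply: leq_trans (Hm a x) _.
by rewrite leq_exp2l //; case: eqP.
Qed.

Lemma bounded_update N m a x e : bounded N m -> a != 0%N ->
  (weight e <= E)%N -> (degree e <= 1)%N ->
  bounded (N + E * s) (update m a x (eval m e)).
Proof.
move=> Hm a0 wE d1 a' x'; rewrite /update; case: ifP => [/andP[/eqP -> _]|_].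
  rewrite (negPf a0); apply: leq_trans (leq_absz_eval e Hm) _.
  by rewrite leq_exp2l //; nia.
by apply: bounded_mono (Hm) _ _; rewrite leq_addr.
Qed.

(* The memory after at most [T] steps: the bit length grows by at most
   [E * s] with each step. *)
Definition runs_within (T N : nat) (m : memory) (P : program) (m' : memory) :=
  exists k, [/\ exec m P k m', bounded (N + T * (E * s)) m' &
                (k <= T * unit_cost (N + T * (E * s)))%N].

Lemma runs_within_seq T1 T2 N m m1 m2 P1 P2 :
  runs_within T1 N m P1 m1 ->
  runs_within T2 (N + T1 * (E * s)) m1 P2 m2 ->
  runs_within (T1 + T2) N m (Seq P1 P2) m2.
Proof.
rewrite /runs_within -addnA -mulnDl => -[k1 [ex1 _ le1]] [k2 [ex2 b2 le2]].
exists (k1 + k2)%N; split=> //; first exact: exec_seq ex1 ex2.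
rewrite mulnDl leq_add // (leq_trans le1) // leq_mul2l unit_cost_mono ?orbT //.
by rewrite mulnDl; lia.
Qed.

Lemma runs_within_mono T T' N m m' P : (T <= T')%N ->
  runs_within T N m P m' -> runs_within T' N m P m'.
Proof.
move=> TT' [k [ex b le]]; have h : (N + T * (E * s) <= N + T' * (E * s))%N.
  by rewrite leq_add2l leq_mul2r TT' orbT.
exists k; split=> //; first exact: bounded_mono b.
by rewrite (leq_trans le) // leq_mul // unit_cost_mono.
Qed.

Lemma runs_within_assign N m a e1 e2 : bounded N m -> a != 0%N ->
  (degree e2 <= 1)%N -> (weight e1 <= E)%N -> (weight e2 <= E)%N ->
  runs_within 1 N m (Assign a e1 e2) (update m a (eval m e1) (eval m e2)).
Proof.
move=> Hm a0 d w1 w2; exists (eval_cost m e1 + eval_cost m e2)%N.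
split; first exact: exec_assign; first by rewrite mul1n; apply: bounded_update.
apply: leq_trans (_ : unit_cost N <= _)%N; last first.
  by rewrite mul1n unit_cost_mono // leq_addr.
by have := unit_cost_ge Hm w1; have := unit_cost_ge Hm w2; lia.
Qed.

(** Induction on the command. The bounds of inner loops stay valid at every pass because the body
    changes arrays in [W] only, and the growth of the bit length is charged to the steps already
    made. *)
Lemma compile_runs Q (W : seq nat) c N m : linear_growth E c -> bounded N m ->
  {subset writes c <= W} -> loops_within Q W m c ->
  runs_within (steps Q c) N m (compile c) (denote c m).
Proof.
elim: c N m => [a e1 e2|c1 IH1 c2 IH2|e c IH|x e c IH] N m /=.
- by case/and4P=> a0 d w1 w2 Hm _ _; apply: runs_within_assign.
- case/andP=> l1 l2 Hm sW [lw1 lw2].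
  have sW1 : {subset writes c1 <= W} by move=> a h; apply: sW; rewrite mem_cat h.
  have sW2 : {subset writes c2 <= W}.
    by move=> a h; apply: sW; rewrite mem_cat h orbT.
  have r1 := IH1 _ _ l1 Hm sW1 lw1; apply: runs_within_seq (r1) _.
  case: r1 => k [_ b _]; apply: IH2 => //; apply: loops_within_eqoff lw2.
  exact: eqoff_sub sW1 (denote_frame c1 m).
- case/andP=> wE lc Hm sW lw; have ce := unit_cost_ge Hm wE.
  have h j : (unit_cost N <= unit_cost (N + j * (E * s)))%N.
    by rewrite unit_cost_mono // leq_addr.
  case: eqP => [e0|/eqP e0] /=.
    exists (eval_cost m e + 1)%N; split.
    + by apply: exec_if_false e0 _; apply: exec_skip.
    + by apply: bounded_mono Hm; rewrite leq_addr.
    by have := h (steps Q c).+2; rewrite mulSn; lia.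
  have [k [ex b le]] := IH _ _ lc Hm sW lw.
  apply: (runs_within_mono (leqnSn _)).
  exists (eval_cost m e + k)%N; split; first exact: exec_if_true.
    by apply: bounded_mono b; rewrite leq_add2l leq_mul2r leqnSn orbT.
  rewrite mulSn leq_add //; first by have := h (steps Q c).+1; lia.
  rewrite (leq_trans le) // leq_mul2l unit_cost_mono ?orbT //.
  by rewrite leq_add2l leq_mul2r leqnSn orbT.
case/and5P=> x0 xW d wE lc Hm sW [eW eQ lw].
have sWc : {subset writes c <= W} by move=> a h; apply: sW; rewrite inE h orbT.
have xinW : x \in W by apply: sW; rewrite mem_head.
rewrite -addn2 addnC -[2%N]/(1 + 1)%N -addnA.
have r0 : runs_within 1 N m (Assign x (Cst 0) e) (update m x 0 (eval m e)).
  by apply: runs_within_assign => //; apply: leq_trans E_ge.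
apply: runs_within_seq (r0) _; case: r0 => k0 [_]; rewrite mul1n => + _.
set m0 := update m x 0 _; move: (N + _)%N => N0 b0.
(* A negative bound makes the counter start below 0, so for zero passes only an upper bound on it is
   available. *)
have xm0 : if trips m e is 0 then m0 x 0 <= 0 else m0 x 0 = (trips m e)%:Z.
  by rewrite /m0 update_eq /trips; case: (eval m e) => [[]|].
have {}lw : loops_within Q W m0 c.
  by apply: loops_within_eqoff lw; apply: eqoff_update.
apply: (@runs_within_mono (trips m e * (steps Q c).+2 + 1)).
  by rewrite addnC leq_add2l leq_mul2r eQ orbT.
move: (trips m e) m0 N0 xm0 b0 lw => {m N Hm k0 eQ} n.
have wx : (weight (Op Leq (Cst 1) (var x)) <= E)%N by apply: leq_trans E_ge.
elim: n => [|n IHn] m N xm Hm lw.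
  exists (eval_cost m (Op Leq (Cst 1) (var x))); split.
  - by apply: exec_while_false; rewrite /= lt_geF // (le_lt_trans xm).
  - by apply: bounded_mono Hm; rewrite leq_addr.
  have : (unit_cost N <= unit_cost (N + 1 * (E * s)))%N.
    by rewrite unit_cost_mono // leq_addr.
  by have := unit_cost_ge Hm wx; rewrite mul0n add0n !mul1n; lia.
have r1 : runs_within 1 N m (Assign x (Cst 0) (Op Defs.Sub (var x) (Cst 1)))
    (update m x 0 n%:Z).
  have -> : n%:Z = eval m (Op Defs.Sub (var x) (Cst 1)) by rewrite /= xm; lia.
  by apply: runs_within_assign => //=; rewrite ?x0 //; apply: leq_trans E_ge.
have lw1 : loops_within Q W (update m x 0 n%:Z) c.
  by apply: loops_within_eqoff lw; apply: eqoff_update.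
have r2 := r1; case: r2 => k1 [_]; rewrite mul1n => + _ => b1.
have r2 := IH _ _ lc b1 sWc lw1.
have r12 : runs_within (1 + steps Q c) N m
    (Seq (Assign x (Cst 0) (Op Defs.Sub (var x) (Cst 1))) (compile c))
    (denote c (update m x 0 n%:Z)).
  by apply: runs_within_seq r1 _; rewrite mul1n.
have fr := denote_frame c (update m x 0 n%:Z).
have xm2 : denote c (update m x 0 n%:Z) x 0 = n%:Z by rewrite (fr x xW) update_eq.
have := r12; case: (r12) => k12 [ex12 b12 le12] _.
have [k [ex b le]] : runs_within (n * (steps Q c).+2 + 1)
    (N + (1 + steps Q c) * (E * s)) (denote c (update m x 0 n%:Z)) (While
    (Op Leq (Cst 1) (var x)) (Seq (Assign x (Cst 0) (Op Defs.Sub (var x) (Cst 1)))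
    (compile c))) (iter_down x (denote c) n (denote c (update m x 0 n%:Z))).
  apply: IHn => //; first by case: n xm2 {xm r1 lw1 b1 r2 r12 fr ex12 b12 le12} => [->|].
  by apply: loops_within_eqoff lw1; apply: eqoff_sub sWc fr.
set N' := (N + (n.+1 * (steps Q c).+2 + 1) * (E * s))%N.
have NN' : (N + (1 + steps Q c) * (E * s) + (n * (steps Q c).+2 + 1) * (E * s) <= N')%N.
  by rewrite /N' -addnA -mulnDl leq_add2l leq_mul2r; apply/orP; right; nia.
have NN1 : (N + (1 + steps Q c) * (E * s) <= N')%N.
  by apply: leq_trans NN'; rewrite leq_addr.
exists (eval_cost m (Op Leq (Cst 1) (var x)) + k12 + k)%N; split.
- by apply: exec_while_true ex12 ex; rewrite /= xm.
- exact: bounded_mono b.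
have h1 : (eval_cost m (Op Leq (Cst 1) (var x)) <= unit_cost N')%N.
  have := unit_cost_ge Hm wx.
  by have : (unit_cost N <= unit_cost N')%N;
    [apply: unit_cost_mono; rewrite /N' leq_addr | lia].
have h2 := leq_trans le12 (leq_mul (leqnn _) (unit_cost_mono NN1)).
have h3 := leq_trans le (leq_mul (leqnn _) (unit_cost_mono NN')).
apply: leq_trans (leq_add (leq_add h1 h2) h3) _.
by rewrite -{1}[unit_cost N']mul1n -!mulnDl leq_mul2r; apply/orP; right; nia.
Qed.

End Cost.

(** * Fair division with interpolated values *)

Definition upto (f : nat -> rat) (b : nat) : rat := \sum_(c < b) f c.

(* [spread f n r / n] is the value of the fraction [r / n] of a copy under the
   piecewise-linear interpolation of [upto f]. *)
Definition spread (f : nat -> rat) (n r : nat) : rat := \sum_(c < r) f (c %/ n)%N.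

Section Concave.
Variable f : nat -> rat.
Hypothesis f_ge0 : forall c, 0 <= f c.
Hypothesis f_noninc : forall c d, (c <= d)%N -> f d <= f c.

Lemma upto_recr b : upto f b.+1 = upto f b + f b.
Proof. by rewrite /upto big_ord_recr. Qed.

Lemma upto_le a b : (a <= b)%N -> upto f a <= upto f b.
Proof.
move=> /subnKC <-; rewrite /upto big_split_ord /= lerDl.
by apply: sumr_ge0.
Qed.

Lemma upto_ge0 b : 0 <= upto f b.
Proof. exact: sumr_ge0. Qed.

(** The first [q * n] terms form [q] blocks of [n] equal terms, one block per full copy; the last
    [s] terms all equal [f q]. *)
Lemma spreadE n q s : (0 < n)%N -> (s <= n)%N ->
  spread f n (q * n + s) = n%:R * upto f q + s%:R * f q.
Proof.
move=> n0; have block q' s' : (s' <= n)%N ->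
    \sum_(i < s') f ((q' * n + i) %/ n)%N = s'%:R * f q'.
  move=> sn; rewrite (eq_bigr (fun=> f q')) ?sumr_const ?card_ord ?mulr_natl //.
  by move=> i _; rewrite divnMDl // divn_small ?addn0 // (leq_trans (ltn_ord i)).
elim: q s => [|q IH] s sn.
  by rewrite /upto big_ord0 mulr0 add0r; apply: (block 0%N).
by rewrite /spread big_split_ord /= block // mulSn addnC -/(spread _ _ _) IH // upto_recr mulrDr.
Qed.

(* [d] is [r / n.+1] rounded down or up, so both [d] and [(r - d) / n] lie in
   the linear piece around [r / n.+1]. *)
Lemma spread_split n r (b : bool) : (0 < n)%N ->
  let d := ((r + n * b) %/ n.+1)%N in
  spread f n.+1 r = upto f d + spread f n (r - d).
Proof.
move=> n0 d; pose q := (r %/ n.+1)%N; pose s := (r %% n.+1)%N.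
have rE : r = (q * n.+1 + s)%N by rewrite -divn_eq.
have sn : (s <= n)%N by rewrite -ltnS ltn_mod.
have dE : d = (q + (b && (0 < s)))%N.
  rewrite /d {1}rE -addnA divnMDl //; congr (_ + _)%N.
  case: b {d} => /=; last by rewrite muln0 addn0 divn_small.
  rewrite muln1; case: s {rE} sn => [|s] sn; first by rewrite add0n divn_small.
  by rewrite addSnnS -[X in (s + X)%N]mul1n divnDMl // divn_small // leqW.
rewrite {1}rE spreadE // 1?leqW // dE; case: (b && (0 < s)%N) / andP => [[_ s0]|_] /=.
  have -> : (r - (q + 1) = q * n + (s - 1))%N by rewrite rE mulnS; lia.
  rewrite spreadE // 1?leq_subLR ?(leq_trans sn) // addn1 upto_recr natrB //.
  by rewrite -[n.+1]addn1 natrD; ring.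
have -> : (r - (q + 0) = q * n + s)%N by rewrite rE mulnS; lia.
by rewrite spreadE // addn0 -[n.+1]addn1 natrD; ring.
Qed.

Lemma spread_ge n r : n.+1%:R * upto f (r %/ n.+1) <= spread f n.+1 r.
Proof.
by rewrite {2}(divn_eq r n.+1) spreadE // 1?ltnW ?ltn_mod // lerDl mulr_ge0.
Qed.

Lemma spread_le n r : spread f n.+1 r <= n.+1%:R * upto f ((r + n) %/ n.+1).
Proof.
pose q := (r %/ n.+1)%N; pose s := (r %% n.+1)%N.
have sn : (s <= n)%N by rewrite -ltnS ltn_mod.
have -> : ((r + n) %/ n.+1 = q + (s + n) %/ n.+1)%N.
  by rewrite {1}(divn_eq r n.+1) -addnA divnMDl.
rewrite {1}(divn_eq r n.+1) -/q -/s spreadE // 1?ltnW ?ltn_mod //.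
have [-> |s0] := posnP s.
  by rewrite add0n (divn_small (ltnSn n)) addn0 mul0r addr0.
apply: le_trans (_ : n.+1%:R * upto f q.+1 <= _).
  rewrite upto_recr mulrDr lerD2l ler_wpM2r // ler_nat leqW //.
rewrite ler_pM2l ?ltr0n // upto_le // -addn1 leq_add2l divn_gt0 //.
by rewrite -add1n leq_add2r.
Qed.

Lemma spread_ge0 n r : 0 <= spread f n r.
Proof. exact: sumr_ge0. Qed.

(* [f (r %/ n)] is a supergradient at [r / n] of the interpolation. *)
Lemma upto_le_spread n r s : (0 < n)%N ->
  n%:R * upto f s <= spread f n r + f (r %/ n)%N * (n%:R * s%:R - r%:R).
Proof.
move=> n0; pose q := (r %/ n)%N.
(* The right-hand side is [n] times the line of slope [f q] through the point of the graph at [q].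
   To the right of [q] every added term is at most [f q], to the left every dropped term is at least
   [f q]. *)
have -> : spread f n r + f q * (n%:R * s%:R - r%:R)
    = n%:R * (upto f q + f q * (s%:R - q%:R)).
  rewrite {1 2}(divn_eq r n) spreadE // 1?ltnW ?ltn_mod // -/q.
  by rewrite natrD natrM; ring.
rewrite ler_wpM2l //; have [qs|/ltnW sq] := leqP q s.
  rewrite -(subnKC qs) /upto big_split_ord /= lerD2l natrD addrC addKr.
  apply: le_trans (_ : \sum_(i < s - q) f q <= _).
    by apply: ler_sum => i _; rewrite f_noninc // leq_addr.
  by rewrite sumr_const card_ord mulr_natr.
rewrite -(subnKC sq) /upto big_split_ord /= -addrA lerDl natrD opprD addrA subrr add0r.
rewrite mulrN subr_ge0.
apply: le_trans (_ : \sum_(i < q - s) f (s + (q - s)) <= _).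
  by rewrite sumr_const card_ord mulr_natr.
by apply: ler_sum => i _; rewrite f_noninc // leq_add2l ltnW.
Qed.

End Concave.

(** * One round of the allocation procedure and its invariant *)

Section Rounds.
Variables (n t : nat) (k : nat -> nat) (v : nat -> nat -> nat -> rat) (z : nat -> rat).
Hypothesis v_ge0 : forall i j c, 0 <= v i j c.
Hypothesis v_noninc : forall i j c d, (c <= d)%N -> v i j d <= v i j c.

Definition worth (i : nat) (b : nat -> nat) : rat := \sum_(j < t) upto (v i j) (b j).

(** Scaled by [r]: [fair i r rem / r] is the interpolated value of [rem j / r] copies of each
    type. *)
Definition fair (i r : nat) (rem : nat -> nat) : rat :=
  \sum_(j < t) spread (v i j) r (rem j).

(* Bundles offered when [r.+1] agents remain, in the order [l = 2t, ..., 0]: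
   first a single copy of type [l - t - 1], then, for [l <= t], the bundles
   with [rem j / r.+1] copies of every type [j], rounded up for [j >= l] and
   down for [j < l]. *)
Definition bundle (r : nat) (rem : nat -> nat) (l j : nat) : nat :=
  ((l <= t.+1 + j) * (t.+1 + j <= l) * (0 < rem j)
   + (l <= t) * ((rem j + r * (l <= j)) %/ r.+1))%N.

(** The bundle is worth at least half of [fair i r.+1 rem / r.+1], with denominators cleared. *)
Definition accepts (i r : nat) (rem : nat -> nat) (l : nat) : bool :=
  fair i r.+1 rem <= 2 * r.+1%:R * worth i (bundle r rem l).

Lemma bundle_le r rem l j : (bundle r rem l j <= rem j)%N.
Proof.
rewrite /bundle; have [lt|lt] := leqP l t.
  have -> : (t.+1 + j <= l)%N = false by lia.
  rewrite muln0 mul0n add0n mul1n -ltnS ltn_divLR //.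
  by case: (l <= j)%N; nia.
rewrite mul0n addn0; case: (rem j) => [|x]; rewrite ?muln0 //.
by case: (l <= _)%N; case: (_ <= l)%N.
Qed.

Lemma bundle_single r rem j : bundle r rem (t.+1 + j) j = (0 < rem j)%N.
Proof.
rewrite /bundle leqnn; have -> : (t.+1 + j <= t)%N = false by lia.
by rewrite mul0n addn0 !mul1n.
Qed.

Lemma bundle_single_neq r rem j j' : j' != j -> bundle r rem (t.+1 + j) j' = 0%N.
Proof.
move=> jj; rewrite /bundle; have -> : (t.+1 + j <= t)%N = false by lia.
by rewrite mul0n addn0 !leq_add2l; case: (ltngtP j j') jj => // ->; rewrite eqxx.
Qed.

Lemma bundle_round r rem l j : (l <= t)%N ->
  bundle r rem l j = ((rem j + r * (l <= j)) %/ r.+1)%N.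
Proof.
move=> lt; rewrite /bundle lt mul1n.
have -> : (t.+1 + j <= l)%N = false by lia.
by rewrite muln0 mul0n add0n.
Qed.

Lemma worth_ge0 i b : 0 <= worth i b.
Proof. by apply: sumr_ge0 => j _; apply: upto_ge0. Qed.

Lemma worth_le i b b' : (forall j, (j < t)%N -> (b j <= b' j)%N) ->
  worth i b <= worth i b'.
Proof. by move=> h; apply: ler_sum => j _; apply: upto_le (h _ _). Qed.

Lemma fair_ge0 i r rem : 0 <= fair i r rem.
Proof. by apply: sumr_ge0 => j _; apply: spread_ge0. Qed.

Lemma worth_single i r rem j : (j < t)%N -> (0 < rem j)%N ->
  worth i (bundle r rem (t.+1 + j)) = v i j 0.
Proof.
move=> jt rj; rewrite /worth (bigD1 (Ordinal jt)) //= bundle_single rj.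
rewrite big1 ?addr0; first by rewrite /upto big_ord_recl big_ord0 addr0.
by move=> j' jj; rewrite bundle_single_neq // /upto big_ord0.
Qed.

(** Bundle 0 rounds every type up, so it is worth even the whole average. Hence no round ends
    without a taker. *)
Lemma accepts_0 i r rem : accepts i r rem 0.
Proof.
apply: le_trans (_ : r.+1%:R * worth i (bundle r rem 0) <= _).
  rewrite /fair /worth mulr_sumr; apply: ler_sum => j _.
  by rewrite bundle_round // muln1 spread_le.
rewrite ler_wpM2r ?worth_ge0 //; have : 0 <= r.+1%:R :> rat by []; lra.
Qed.

(** Rounding to a neighbouring integer stays within one linear piece, so no interpolated value is
    lost. *)
Lemma fair_split i r rem l : (0 < r)%N -> (l <= t)%N ->
  fair i r.+1 rem = worth i (bundle r rem l)
    + fair i r (fun j => rem j - bundle r rem l j)%N.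
Proof.
move=> r0 lt; rewrite /fair /worth -big_split /=; apply: eq_bigr => j _.
by rewrite bundle_round // -spread_split.
Qed.

(* Bundle [l] exceeds the rejected bundle [l.+1] by at most one copy, and that
   copy alone was rejected as well. *)
Lemma worth_le_fair i r rem l : (l <= t)%N ->
  (forall l', (l < l')%N -> (l' <= 2 * t)%N -> ~~ accepts i r rem l') ->
  r.+1%:R * worth i (bundle r rem l) <= fair i r.+1 rem.
Proof.
move=> lt rej; have r0 : 0 < r.+1%:R :> rat by rewrite ltr0n.
(* For [l = t] every type is rounded down and the bound is immediate. *)
have [lt'|tl] := ltnP l t; last first.
  have -> : l = t by lia.
  rewrite /fair /worth mulr_sumr; apply: ler_sum => j _.
  by rewrite bundle_round // leqNgt ltn_ord muln0 addn0 spread_ge.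
have [rej1 rej2] : ~~ accepts i r rem l.+1 /\ ~~ accepts i r rem (t.+1 + l).
  by split; apply: rej; lia.
have bS j := bundle_round r rem j lt'; have bl j := bundle_round r rem j lt.
have w0 := worth_ge0 i (bundle r rem l.+1).
(* Passing from [l.+1] to [l] changes the rounding of type [l] only; by concavity the extra copy is
   worth at most a first copy. *)
have : worth i (bundle r rem l) <= worth i (bundle r rem l.+1) + (0 < rem l)%N%:R * v i l 0.
  rewrite /worth (bigD1 (Ordinal lt')) //= [leRHS](_ : _ =
    upto (v i l) (bundle r rem l.+1 l) + (0 < rem l)%N%:R * v i l 0 +
    \sum_(j < t | j != Ordinal lt') upto (v i j) (bundle r rem l.+1 j)); last first.
    by rewrite (bigD1 (Ordinal lt')) //=; ring.
  apply: lerD; last first.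
    apply: ler_sum => j jl; rewrite upto_le // bl bS.
    by move: jl; rewrite -val_eqE /= => jl; rewrite (_ : (l < j)%N = (l <= j)%N) //; lia.
  rewrite bl bS leqnn ltnn muln1 muln0 addn0.
  case: (rem l) => [|x] /=; first by rewrite add0n divn_small // div0n mul0r addr0.
  apply: le_trans (_ : upto (v i l) (x.+1 %/ r.+1).+1 <= _).
    rewrite upto_le // -ltnS ltn_divLR //.
    by have := ltn_ceil x.+1 (ltn0Sn r); nia.
  by rewrite upto_recr mul1r lerD2l v_noninc.
case: (posnP (rem l)) => [|] rl le_w.
  rewrite mul0r addr0 in le_w.
  move: rej1; rewrite /accepts -ltNge; nra.
move: rej1 rej2; rewrite /accepts -!ltNge worth_single //.
rewrite mul1r in le_w; nra.
Qed.

Definition remaining (u : nat -> nat) (j : nat) : nat := (k j - u j)%N.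

Definition owned (u : nat -> nat) (own : nat -> nat -> int) (i j : nat) : nat :=
  (\sum_(c < u j) (own j c == i%:Z))%N.

(* [z i] is the share of agent [i] and [r] agents are left.  Either only single
   copies have been handed out, or no remaining copy is large for a remaining agent. *)
Definition fair_state (r : nat) (u : nat -> nat) (done : nat -> bool)
    (own : nat -> nat -> int) : Prop :=
  [/\ forall j, (j < t)%N -> (u j <= k j)%N,
      (\sum_(i < n) ~~ done i)%N = r,
      forall i, (i < n)%N -> done i -> z i <= 2 * worth i (owned u own i),
      forall j c, (j < t)%N -> (c < k j)%N -> exists2 i, (i < n)%N & own j c = i%:Z &
      (\sum_(j < t) u j + r <= n)%N \/
      forall i, (i < n)%N -> ~~ done i ->
        z i * r%:R <= fair i r (remaining u) /\
        forall j, (j < t)%N -> (0 < remaining u j)%N ->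
          2 * r%:R * v i j 0 < fair i r (remaining u)].

Hypothesis z_le : forall u r i, (0 < r)%N -> (i < n)%N ->
  (forall j, (j < t)%N -> (u j <= k j)%N) -> (\sum_(j < t) u j + r <= n)%N ->
  z i * r%:R <= fair i r (remaining u).

Lemma fair_state_active r u done own : fair_state r.+1 u done own ->
  exists2 i, (i < n)%N & ~~ done i.
Proof.
case=> _ cnt _ _ _; case: (pickP (fun i : 'I_n => ~~ done i)) => [i di|all_done].
  by exists i.
by move: cnt; rewrite big1 // => i _; rewrite all_done.
Qed.

Section Step.
Variables (r i l : nat) (u : nat -> nat) (done done' : nat -> bool) (own own' : nat -> nat -> int).
Let b := bundle r (remaining u) l.
Let u' j := (u j + b j)%N.
Hypotheses (st : fair_state r.+1 u done own) (i_lt : (i < n)%N) (i_active : ~~ done i).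
Hypothesis acc : accepts i r (remaining u) l.
Hypothesis rej : forall i' l', (i' < n)%N -> ~~ done i' -> (l < l')%N -> (l' <= 2 * t)%N ->
  ~~ accepts i' r (remaining u) l'.
Hypothesis l_le : (l <= 2 * t)%N.
Hypothesis done'E : forall i', (i' < n)%N -> done' i' = (i' == i) || done i'.
Hypothesis own'E : forall j c, (j < t)%N -> (c < k j)%N ->
  own' j c = if (u j <= c < u j + b j)%N then i%:Z else own j c.

(** The taker is satisfied by [acc] together with the lower bound on [fair]. What needs care is the
    last clause of the invariant; its proof separates the last agent, a rounded bundle, and a single
    copy. *)
Lemma fair_state_step : fair_state r u' done' own'.
Proof.
case: st => u_le cnt dn ow inv.
have u'_le j : (j < t)%N -> (u' j <= k j)%N.
  by move=> jt; rewrite -leq_subRL ?u_le // bundle_le.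
have r_le : (r.+1 <= n)%N.
  by rewrite -cnt -[leqRHS]card_ord -sum1_card leq_sum // => j _; case: (done j).
have zi i' : (i' < n)%N -> ~~ done i' -> z i' * r.+1%:R <= fair i' r.+1 (remaining u).
  move=> lt di; case: inv => [sum_le|/(_ i' lt di)[]//]; exact: z_le.
have rp : 0 < r.+1%:R :> rat by rewrite ltr0n.
split=> //.
- move: cnt; rewrite (bigD1 (Ordinal i_lt)) //= i_active add1n => -[<-].
  rewrite (bigD1 (Ordinal i_lt)) //= done'E // eqxx add0n.
  by apply: eq_bigr => i' ii; rewrite done'E //; move: ii; rewrite -val_eqE /= => /negPf ->.
- move=> i' lt; rewrite done'E // => /orP[/eqP ->|di].
    apply: le_trans (_ : 2 * worth i b <= _).
      by have := le_trans (zi i i_lt i_active) acc; rewrite -/b; nra.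
    rewrite ler_wpM2l // worth_le // => j jt; rewrite /owned.
    rewrite big_split_ord /= (leq_trans _ (leq_addl _ _)) //.
    rewrite -[leqLHS]card_ord -sum1_card leq_sum // => c _.
    rewrite own'E ?leq_addr ?ltn_add2l ?ltn_ord ?eqxx //.
    by apply: leq_trans (u'_le _ jt); rewrite ltn_add2l.
  apply: le_trans (dn i' lt di) _; rewrite ler_wpM2l // worth_le // => j jt.
  rewrite /owned big_split_ord /= (leq_trans _ (leq_addr _ _)) // leq_sum // => c _.
  have ck : (c < k j)%N by apply: leq_trans (u_le j jt).
  by rewrite own'E // [(u j <= c)%N]leqNgt ltn_ord.
- move=> j c jt ck; rewrite own'E //; case: ifP => _; last exact: ow.
  by exists i.
(* With [r = 0] a second active agent would contradict the count, so the clause is vacuous. *)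
have [r0|r_gt0] := posnP r.
  right=> i' lt; rewrite done'E // negb_or => /andP[ii di].
  suff : (1 < r.+1)%N by rewrite r0.
  rewrite -cnt (bigD1 (Ordinal i_lt)) //= i_active (bigD1 (Ordinal lt)) ?di //.
have lt' : (l <= t)%N \/ exists2 j, (j < t)%N & l = (t.+1 + j)%N.
  by have [|] := leqP l t; [left | right; exists (l - t.+1)%N; lia].
case: lt' => [lt|[j0 j0t lE]].
  right=> i' lti; rewrite done'E // negb_or => /andP[_ di].
  have rm j : (remaining u' j = remaining u j - b j)%N by rewrite /remaining subnDA.
  have := fair_split i' (remaining u) r_gt0 lt.
  have := worth_le_fair lt (fun l' => rej lti di).
  have -> : fair i' r (fun j => remaining u j - bundle r (remaining u) l j)%N
      = fair i' r (remaining u').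
    by apply: eq_bigr => j _; rewrite rm.
  have := zi i' lti di; rewrite -/b.
  have B j : (j < t)%N -> (0 < remaining u j)%N ->
      2 * r.+1%:R * v i' j 0 < fair i' r.+1 (remaining u).
    move=> jt rj; have := rej lti di (l' := t.+1 + j).
    by rewrite /accepts -ltNge worth_single //; apply; lia.
  have rr : 0 < r%:R :> rat by rewrite ltr0n.
  move: B; rewrite -natr1; move: (fair i' r.+1 _) (fair i' r _) (worth _ _) => G G' w B h1 h2 h3.
  (* The bundle is worth at most [G / (r + 1)], so the average [G' / r] of what is left is at least
     [G / (r + 1)]. Both the share bound and the smallness of single copies carry over. *)
  have GG : G * r%:R <= G' * (r%:R + 1) by nra.
  have r1p : 0 < r%:R + 1 :> rat by lra.
  split=> [|j jt]; first by rewrite -(ler_pM2r r1p); nra.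
  rewrite rm => rj; have {}rj : (0 < remaining u j)%N by lia.
  rewrite -(ltr_pM2r r1p); apply: lt_le_trans GG.
  have : 2 * (r%:R + 1) * v i' j 0 * r%:R < G * r%:R by rewrite natr1 ltr_pM2r // B.
  lra.
have b0 j : j != j0 -> b j = 0%N by move=> jj; rewrite /b lE bundle_single_neq.
have bj0 : b j0 = (0 < remaining u j0)%N by rewrite /b lE bundle_single.
(* While only single copies are handed out, one agent leaves with at most one copy, which keeps the
   sum bound. *)
case: inv => [sum_le|inv].
  left; rewrite /u' big_split /= -addnA.
  apply: leq_trans (_ : \sum_(j < t) u j + r.+1 <= n)%N => //.
  rewrite leq_add2l -add1n leq_add2r (bigD1 (Ordinal j0t)) //= bj0 big1 ?addn0.
    by case: (0 < _)%N.
  by move=> j jj; rewrite b0 //; rewrite -val_eqE in jj.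
have [_ Bi] := inv i i_lt i_active.
(* Once all remaining copies are small, a single copy can be accepted only if nothing is left at
   all; then [fair] is 0 and the shares of the active agents are at most 0. *)
have rem0 j : (j < t)%N -> remaining u j = 0%N.
  move=> jt; apply/eqP; rewrite -leqn0 leqNgt; apply/negP => rj.
  have := acc; rewrite /accepts; have := Bi j jt rj.
  have [rj0|rj0] := posnP (remaining u j0).
    rewrite (_ : worth i _ = 0); first by have := v_ge0 i j 0; nra.
    rewrite /worth big1 // => j' _; rewrite -/b.
    have -> : b j' = 0%N by have [->|/b0 //] := eqVneq (j' : nat) j0; rewrite bj0 rj0.
    by rewrite /upto big_ord0.
  by rewrite lE worth_single //; have := Bi j0 j0t rj0; nra.
right=> i' lti; rewrite done'E // negb_or => /andP[_ di].
have rem0' j : (j < t)%N -> remaining u' j = 0%N.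
  by move=> jt; rewrite /remaining subnDA -/(remaining u j) rem0.
split=> [|j jt]; last by rewrite rem0'.
have f0 s w : (forall j, (j < t)%N -> remaining w j = 0%N) -> fair i' s (remaining w) = 0.
  by move=> h; apply: big1 => j _; rewrite h // /spread big_ord0.
have := zi i' lti di; rewrite !f0 // => h; have rr : 0 < r%:R :> rat by rewrite ltr0n.
nra.
Qed.

End Step.
End Rounds.

(** * The any price share and the interpolated fair share *)

Section Shares.
Variable I : instance.
Let n := agents I.
Let t := types I.

(* Indexed by natural numbers, with value 0 out of range. *)
Definition ncopies (j : nat) : nat :=
  if (insub j : option 'I_t) is Some j' then copies j' else 0.

Definition nvalue (i j c : nat) : rat :=
  if (insub i : option 'I_n) is Some i' then
    if (insub j : option 'I_t) is Some j' then
      if (insub c : option 'I_(copies j')) is Some c' then value i' c' else 0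
    else 0
  else 0.

Lemma ncopiesE (j : 'I_t) : ncopies j = copies j.
Proof. by rewrite /ncopies valK. Qed.

Lemma nvalueE (i : 'I_n) (j : 'I_t) (c : 'I_(copies j)) : nvalue i j c = value i c.
Proof. by rewrite /nvalue !valK. Qed.

Lemma nvalue_ge0 i j c : 0 <= nvalue i j c.
Proof.
rewrite /nvalue; case: insub => // i'; case: insub => // j'; case: insub => // c'.
exact: value_ge0.
Qed.

Lemma nvalue_noninc i j c d : (c <= d)%N -> nvalue i j d <= nvalue i j c.
Proof.
rewrite /nvalue; case: insub => // i'; case: insub => // j' cd.
case: (insubP _ d) => [d' dk dE|_].
  by rewrite (insubT (fun c => c < copies j')%N (leq_ltn_trans cd dk)) value_noninc /= ?dE.
by case: insub => // c'; apply: value_ge0.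
Qed.

Lemma card_type (j : 'I_t) (P : pred nat) :
  #|[set g : good I | (tag g == j) && P (tagged g)]| = (\sum_(c < copies j) P c)%N.
Proof.
rewrite -[RHS](@big_mkcond _ _ _ _ _ (fun c : 'I__ => P c) (fun=> 1%N)) /=.
have inj : injective (fun c : 'I_(copies j) => Tagged (fun j => 'I_(copies j)) c : good I).
  by move=> c d /eqP; rewrite -tag_eqE /tag_eq /= eqxx tagged_asE => /eqP.
rewrite sum1_card -[RHS](card_imset _ inj); apply: eq_card.
move=> g; apply/idP/imsetP; rewrite inE.
  by case: g => j' c /= /andP[/eqP E]; case: _ / E c => c Pc; exists c.
by case=> c Pc ->; rewrite /= eqxx.
Qed.

Lemma sum_by_type (S : {set good I}) (F : 'I_t -> rat) :
  \sum_(g in S) F (tag g) = \sum_(j < t) #|S :&: copies_of j|%:R * F j.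
Proof.
rewrite (partition_big (fun g : good I => tag g) xpredT) //=; apply: eq_bigr => j _.
rewrite (eq_bigr (fun=> F j)); last by move=> g /andP[_ /eqP ->].
by rewrite sumr_const mulr_natl; congr (_ *+ _); apply: eq_card => g; rewrite !inE.
Qed.

Lemma card_copies_of (j : 'I_t) : #|copies_of (I := I) j| = copies j.
Proof.
have := card_type j xpredT; rewrite sum_nat_const card_ord muln1 => <-.
by apply: eq_card => g; rewrite !inE andbT.
Qed.

Lemma card_type_le (S : {set good I}) (j : 'I_t) : (#|S :&: copies_of j| <= copies j)%N.
Proof.
by rewrite -card_copies_of subset_leq_card // subsetIr.
Qed.

Lemma valuationE (i : 'I_n) (S : {set good I}) :
  valuation i S = \sum_(j < t) upto (nvalue i j) #|S :&: copies_of j|.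
Proof.
apply: eq_bigr => j _; rewrite /upto.
rewrite (big_ord_widen (copies j) (nvalue i j)) ?card_type_le //.
by apply: eq_bigr => c _; rewrite nvalueE.
Qed.

(** Weights before normalization: each of the [u j] removed copies gets [y], slightly more than the
    budget, and every other copy gets its supporting slope plus [e]. An affordable bundle then
    avoids the removed copies, and concavity bounds its value. The slack [e] makes the inequalities
    strict and the total weight positive. *)
Lemma APS_fair_approx (R : realType) (i : 'I_n) (u : nat -> nat) (r : nat) (e : rat) :
  (0 < #|good I|)%N -> (0 < r)%N -> 0 < e ->
  (forall j, (j < t)%N -> (u j <= ncopies j)%N) -> (\sum_(j < t) u j + r <= n)%N ->
  exists2 p : good I -> R, price_vector p &
    best_affordable i (1 / n%:R) p * r%:R <=
      fair t nvalue i r (remaining ncopies u) + e * (#|good I|%:R + 1).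
Proof.
move=> G0 r0 e0 u_le ur.
pose rem := remaining ncopies u.
pose lam (j : nat) := nvalue i j (rem j %/ r).
have lam0 j : 0 <= lam j by apply: nvalue_ge0.
pose Rm := [set g : good I | (tagged g < u (tag g))%N].
pose L := \sum_(j < t) (rem j)%:R * (lam j + e).
have L0 : 0 <= L by apply: sumr_ge0 => j _; rewrite mulr_ge0 // addr_ge0 // ltW.
have rp : 0 < r%:R :> rat by rewrite ltr0n.
(* Chosen so that [r] budgets just exceed the weight [L] of the copies that stay. *)
pose y := (L + e) / r%:R.
have y0 : 0 < y by rewrite divr_gt0 // ltr_wpDl.
have ry : y * r%:R = L + e by rewrite /y divfK // gt_eqF.
pose w (g : good I) := if g \in Rm then y else lam (tag g) + e.
have w0 g : 0 < w g by rewrite /w; case: ifP => // _; rewrite ltr_wpDl.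
have cardRm (j : 'I_t) : #|Rm :&: copies_of j| = u j.
  transitivity #|[set g : good I | (tag g == j) && (tagged g < u j)%N]|.
    by apply: eq_card => g; rewrite !inE andbC; case: eqP => //= <-.
  rewrite (card_type j (fun c => c < u j)%N) -(big_mkcond (fun c : 'I__ => c < u j)%N (fun=> 1%N)).
  by rewrite -(big_ord_widen _ (fun=> 1%N)) ?sum1_card ?card_ord // -ncopiesE u_le.
have cardRmC (j : 'I_t) : #|~: Rm :&: copies_of j| = rem j.
  apply/eqP; rewrite -(eqn_add2l (u j)) -{1}cardRm /rem /remaining subnKC ?u_le //.
  by rewrite ncopiesE -card_copies_of setIC (setIC (~: _)) -setDE cardsID.
have sumRm : #|Rm| = (\sum_(j < t) u j)%N.
  rewrite -sum1_card (partition_big (fun g : good I => tag g) xpredT) //=.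
  apply: eq_bigr => j _; rewrite -cardRm -sum1_card; apply: eq_bigl => g.
  by rewrite !inE.
have sumw : \sum_g w g = #|Rm|%:R * y + L.
  rewrite (bigID (mem Rm)) /= (eq_bigr (fun=> y)); last by move=> g gR; rewrite /w ifT.
  rewrite sumr_const mulr_natl; congr (_ + _).
  rewrite (eq_bigr (fun g : good I => lam (tag g) + e)); last by move=> g gR; rewrite /w ifN.
  rewrite (eq_bigl (mem (~: Rm))); last by move=> g; rewrite !inE.
  by rewrite (sum_by_type _ (fun j : 'I_t => lam j + e)); apply: eq_bigr => j _; rewrite cardRmC.
have T0 : 0 < \sum_g w g.
  case/card_gt0P: G0 => g0 _; rewrite (bigD1 g0) //= ltr_pwDl //.
  by apply: sumr_ge0 => g _; apply: ltW.
have np : 0 < n%:R :> rat by rewrite ltr0n; apply: leq_trans ur; rewrite addn_gt0 r0 orbT.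
(* There are at most [n - r] removed copies and [L < r * y], so the budget, a fraction [1/n] of the
   total, is below [y]. *)
have T_lt : \sum_g w g < n%:R * y.
  have : (#|Rm| + r)%:R * y <= n%:R * y by rewrite ler_wpM2r ?ler_nat ?sumRm // ltW.
  by rewrite sumw natrD mulrDl [r%:R * y]mulrC ry; lra.
exists (fun g => ratr (w g / \sum_g w g)).
  split=> [g|]; first by rewrite ler0q divr_ge0 // ltW.
  by rewrite -rmorph_sum -mulr_suml divff ?rmorph1 // gt_eqF.
rewrite -ler_pdivlMr // /best_affordable.
(* The default value 0 of the maximum has to satisfy the bound too. *)
set B := _ / r%:R; apply: (big_ind (fun x => x <= B)) => [||S]; rewrite {}/B.
- rewrite divr_ge0 // addr_ge0 ?fair_ge0 //; first exact: nvalue_ge0.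
  by rewrite mulr_ge0 ?(ltW e0) // addr_ge0.
- by move=> a b ha hb; rewrite ge_max ha.
rewrite -rmorph_sum -mulr_suml /= => S_aff.
have {}S_aff : (\sum_(g in S) w g) / (\sum_g w g) <= 1 / n%:R.
  by rewrite -(ler_rat R) [leRHS]fmorph_div rmorph1 rmorph_nat.
have {}S_aff : \sum_(g in S) w g < y.
  move: S_aff; rewrite ler_pdivrMr // mulrC mul1r ler_pdivlMr // => h.
  by rewrite -(ltr_pM2r np) [y * _]mulrC (le_lt_trans h).
have SRm g : g \in S -> g \notin Rm.
  move=> gS; apply/negP => gR; move: S_aff; rewrite (bigD1 g) //= {1}/w gR.
  by rewrite gtrDl ltNge sumr_ge0 // => g' _; apply: ltW.
move: S_aff; rewrite (eq_bigr (fun g : good I => lam (tag g) + e)); last first.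
  by move=> g gS; rewrite /w ifN // SRm.
rewrite (sum_by_type _ (fun j : 'I_t => lam j + e)) -(ltr_pM2r rp) ry => S_aff.
rewrite ler_pdivlMr // valuationE mulr_suml.
(* The slope [lam j] supports the interpolation at [rem j / r]. *)
apply: le_trans (_ : \sum_(j < t) (spread (nvalue i j) r (rem j)
   + lam j * (r%:R * #|S :&: copies_of j|%:R - (rem j)%:R)) <= _).
  apply: ler_sum => j _; rewrite mulrC.
  by apply: upto_le_spread => // c d; apply: nvalue_noninc.
rewrite big_split lerD2l /=.
have rem_le : \sum_(j < t) (rem j)%:R <= #|good I|%:R :> rat.
  apply: le_trans (_ : #|~: Rm|%:R <= _); last by rewrite ler_nat max_card.
  have := sum_by_type (~: Rm) (fun=> 1); rewrite sumr_const => ->.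
  by apply: ler_sum => j _; rewrite cardRmC mulr1.
have s0 : 0 <= \sum_(j < t) #|S :&: copies_of j|%:R :> rat by apply: sumr_ge0.
apply: le_trans (_ : e * \sum_(j < t) (rem j)%:R + e <= _); last first.
  by rewrite mulrDr mulr1 lerD2r ler_wpM2l // ltW.
(* Affordability controls this linear term: the bundle weighs less than [y], and [y * r] is only [e]
   above [L]. *)
have -> : \sum_(j < t) lam j * (r%:R * #|S :&: copies_of j|%:R - (rem j)%:R) =
   (\sum_(j < t) #|S :&: copies_of j|%:R * (lam j + e)) * r%:R - L
   - e * (r%:R * \sum_(j < t) #|S :&: copies_of j|%:R) + e * \sum_(j < t) (rem j)%:R.
  rewrite /L !mulr_suml !mulr_sumr -!sumrN -!big_split /=.
  by apply: eq_bigr => j _; ring.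
have : 0 <= e * (r%:R * \sum_(j < t) #|S :&: copies_of j|%:R).
  by rewrite !mulr_ge0 // ltW.
by move: S_aff; lra.
Qed.

(** The share is attained by some prices, hence it is the rational value of a bundle or 0. If it
    violated the bound, [APS_fair_approx] with small enough [e] would give better prices. *)
Lemma APS_fair (R : realType) : (0 < #|good I|)%N -> exists z : nat -> rat,
  (forall i : 'I_n, APS i (1 / n%:R) = ratr (z i) :> R) /\
  forall u r i, (0 < r)%N -> (i < n)%N ->
    (forall j, (j < t)%N -> (u j <= ncopies j)%N) -> (\sum_(j < t) u j + r <= n)%N ->
    z i * r%:R <= fair t nvalue i r (remaining ncopies u).
Proof.
move=> G0; have := fun i => @APS_attained R I i (1 / n%:R) G0.
move=> /fin_all_exists[p pP].
pose z (i : nat) := if (insub i : option 'I_n) is Some i' then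
  best_affordable i' (1 / n%:R) (p i') else 0.
have zE (i : 'I_n) : z i = best_affordable i (1 / n%:R) (p i) by rewrite /z valK.
exists z; split=> [i|u r i r0 lt u_le ur]; first by rewrite zE; case: (pP i).
have [_ _ minp] := pP (Ordinal lt); rewrite -[i]/(val (Ordinal lt)) zE.
set B := best_affordable _ _ _ in minp *; rewrite leNgt; apply/negP => gt.
set F := fair _ _ _ _ _ in gt; have Mp : 0 < #|good I|%:R + 1 :> rat by rewrite ltr_wpDl.
(* This makes the error term half of the supposed gap. *)
pose e := (B * r%:R - F) / (2 * (#|good I|%:R + 1)).
have e0 : 0 < e by rewrite divr_gt0 ?subr_gt0 // mulr_gt0.
have [p' /minp le_B] := @APS_fair_approx R (Ordinal lt) u r e G0 r0 e0 u_le ur.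
apply/negP; rewrite -ltNge -/F.
have -> : e * (#|good I|%:R + 1) = (B * r%:R - F) / 2.
  by rewrite /e; field; rewrite gt_eqF.
have := ler_wpM2r (ler0n rat r) le_B; move: gt; lra.
Qed.

End Shares.

(** * The program and its correctness *)

Notation "x +e y" := (Op Add x y) (at level 50, left associativity).
Notation "x -e y" := (Op Defs.Sub x y) (at level 50, left associativity).
Notation "x *e y" := (Op Mul x y) (at level 40, left associativity).
Notation "x /e y" := (Op Quo x y) (at level 40, left associativity).
Notation "x <=e y" := (Op Leq x y) (at level 70).
Notation "c1 ;; c2" := (CSeq c1 c2) (at level 90, right associativity).

Local Notation OWN := 1%N.
Local Notation OFF := 2%N.
Local Notation DEN := 3%N.
Local Notation USED := 4%N.
Local Notation DONE := 5%N.
Local Notation FAIR := 6%N.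
Local Notation WORTH := 7%N.
Local Notation FOUND := 8%N.
Local Notation RR := 10%N.
Local Notation LL := 11%N.
Local Notation II := 12%N.
Local Notation JJ := 13%N.
Local Notation CC := 14%N.

Definition nE := Get 0 (Cst 0).
Definition tE := Get 0 (Cst 1).
(* Without goods nothing is done: the number of agents may then be exponential
   in the length of the input. *)
Definition agentsE := nE *e (Cst 1 <=e Get OFF tE).
Definition kE (j : expr) := Get 0 (Cst 2 +e j).
Definition sizeE := Get OFF tE.
Definition remE := kE (var JJ) -e Get USED (var JJ).
Definition singleE := tE +e Cst 1 +e var JJ.
Definition bundleE :=
  (var LL <=e singleE) *e (singleE <=e var LL) *e (Cst 1 <=e remE)
  +e (var LL <=e tE) *e
     ((remE +e var RR *e (var LL <=e var JJ)) /e (var RR +e Cst 1)).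
Definition addrE (p : expr) :=
  Cst 2 +e tE +e Cst 2 *e (var II *e sizeE +e (Get OFF (var JJ) +e p)).
(** Scaling by the common denominator turns comparisons into integer ones. Entries of the input
    count as constants, so the degree is 1. *)
Definition valueE (p : expr) :=
  Get 0 (addrE p) *e (var DEN /e Get 0 (addrE p +e Cst 1)).

(** Each prefix sum is accumulated on its own: loops count down, so the preceding one is not known
    yet. Cell [t] receives the number of goods. *)
Definition offsets :=
  CFor LL (tE +e Cst 1) (CFor JJ tE
    (CAssign OFF (var LL)
      (Get OFF (var LL) +e kE (var JJ) *e (var JJ +e Cst 1 <=e var LL)))).

Definition denominators :=
  assign DEN (Cst 1) ;;
  CFor CC (nE *e sizeE)
    (assign DEN (var DEN *e Get 0 (Cst 2 +e tE +e Cst 2 *e var CC +e Cst 1))).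

(** Loop bounds must not read arrays that are written, so the inner loop always runs [sizeE] times
    and a factor 0 or 1 cuts the sums off. *)
Definition evaluate :=
  CFor JJ tE (CFor CC sizeE (
    assign FAIR (var FAIR +e
      valueE (var CC /e (var RR +e Cst 1)) *e (var CC +e Cst 1 <=e remE)) ;;
    assign WORTH (var WORTH +e
      valueE (var CC) *e (var CC +e Cst 1 <=e bundleE)))).

Definition give :=
  CFor JJ tE (
    CFor CC sizeE (CIf (var CC +e Cst 1 <=e bundleE)
      (CAssign OWN (Get OFF (var JJ) +e Get USED (var JJ) +e var CC) (var II))) ;;
    CAssign USED (var JJ) (Get USED (var JJ) +e bundleE)).

(** Loops cannot be left early; [FOUND] disables all later offers of a round. *)
Definition offer :=
  (assign FAIR (Cst 0) ;; assign WORTH (Cst 0) ;; evaluate) ;;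
  CIf ((var FOUND <=e Cst 0) *e (Get DONE (var II) <=e Cst 0) *e
       (var FAIR <=e Cst 2 *e (var RR +e Cst 1) *e var WORTH))
    (assign FOUND (Cst 1) ;; CAssign DONE (var II) (Cst 1) ;; give).

Definition round :=
  assign FOUND (Cst 0) ;;
  CFor LL (Cst 2 *e tE +e Cst 1) (CFor II agentsE offer).

Definition rounds := CFor RR agentsE round.

(** * Proof rules for loops *)

Lemma eval_add m e1 e2 : eval m (e1 +e e2) = eval m e1 + eval m e2.
Proof. by []. Qed.

Lemma denote_if e c m : denote (CIf e c) m = if eval m e != 0 then denote c m else m.
Proof. by []. Qed.

Lemma denote_seq c1 c2 m : denote (c1 ;; c2) m = denote c2 (denote c1 m).
Proof. by []. Qed.

Lemma for_ind x e c m (Q : nat -> memory -> Prop) :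
  Q (trips m e) (update m x 0 (eval m e)) ->
  (forall i m', (i < trips m e)%N -> Q i.+1 m' -> Q i (denote c (update m' x 0 i%:Z))) ->
  Q 0%N (denote (CFor x e c) m).
Proof. exact: iter_down_ind. Qed.

(** The invariant adds the contributions of the passes still to come, with smaller counters, to the
    current content of the cell. *)
Lemma for_sum x e c m a y (h : nat -> int) :
  a != x -> x \notin writes c ->
  (forall i m', (i < trips m e)%N -> eqoff (x :: writes c) m m' -> m' x 0 = i%:Z ->
     denote c m' a y = m' a y + h i) ->
  denote (CFor x e c) m a y = m a y + \sum_(i < trips m e) h i.
Proof.
move=> ax xc body.
pose Q i m' := eqoff (x :: writes c) m m' /\
  m' a y + \sum_(i' < i) h i' = m a y + \sum_(i < trips m e) h i.
suff : Q 0%N (denote (CFor x e c) m) by case=> _; rewrite big_ord0 addr0.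
have upd_a m' v : update m' x 0 v a y = m' a y.
  by rewrite /update (negPf ax).
have upd_off m' v : eqoff (x :: writes c) m' (update m' x 0 v).
  by apply: eqoff_update; rewrite mem_head.
apply: for_ind; first by split; [apply: upd_off | rewrite upd_a].
move=> i m' lt [off tot]; have off' := eqoff_trans off (upd_off m' i%:Z); split.
  apply: eqoff_trans off' (eqoff_sub _ (denote_frame c _)).
  by move=> b; rewrite inE orbC => ->.
by rewrite (body i) ?update_eq // upd_a -tot big_ord_recr /=; ring.
Qed.

(** The position of the first copy of type [l] in the list of goods. *)
Definition start (k : nat -> nat) (l : nat) : nat := (\sum_(j < l) k j)%N.

Section Start.
Variables (t : nat) (k : nat -> nat).
Local Notation start := (start k).
Local Notation size := (start t).

Lemma start_le j : (j < t)%N -> (start j + k j <= size)%N.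
Proof.
move=> jt; rewrite /start -(subnKC jt) big_split_ord /= big_ord_recr /=.
exact: leq_addr.
Qed.

Lemma k_le_size j : (j < t)%N -> (k j <= size)%N.
Proof. by move/start_le; apply: leq_trans; rewrite leq_addl. Qed.

Lemma start_disjoint j j' c c' : (j < t)%N -> (j' < t)%N -> (c < k j)%N -> (c' < k j')%N ->
  (start j + c = start j' + c')%N -> j = j'.
Proof.
have lt a b : (a < b)%N -> (start a + k a <= start b)%N.
  move=> ab; rewrite /start -(subnKC ab) big_split_ord /= big_ord_recr /=.
  exact: leq_addr.
by move=> _ _ ck ck' E; case: (ltngtP j j') => // /lt; lia.
Qed.

Lemma start_lt j c : (j < t)%N -> (c < k j)%N -> (start j + c < size)%N.
Proof. by move=> jt ck; have := start_le jt; lia. Qed.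

End Start.

Arguments start_le {t k j}.
Arguments k_le_size {t} k {j}.
Arguments start_lt {t k j c}.

(** * What the program computes, for an abstract input layout *)

Section Correctness.
Variables (n t : nat) (k : nat -> nat) (v : nat -> nat -> nat -> rat) (inp : int -> int).
Local Notation start := (start k).
Local Notation size := (start t).
Hypothesis inp_n : inp 0 = n%:Z.
Hypothesis inp_t : inp 1 = t%:Z.
Hypothesis inp_k : forall j, (j < t)%N -> inp (2 + j%:Z) = (k j)%:Z.
Hypothesis inp_num : forall i j c, (i < n)%N -> (j < t)%N -> (c < k j)%N ->
  inp (2 + t + 2 * (i * size + (start j + c)))%N%:Z = numq (v i j c).
Hypothesis inp_den : forall i j c, (i < n)%N -> (j < t)%N -> (c < k j)%N ->
  inp (2 + t + 2 * (i * size + (start j + c)) + 1)%N%:Z = denq (v i j c).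
Hypothesis inp_den_gt0 : forall x, (x < n * size)%N -> 0 < inp (2 + t + 2 * x + 1)%N%:Z.

Lemma denote_offsets m y : m 0%N =1 inp -> m OFF =1 (fun=> 0) -> (y <= t)%N ->
  denote offsets m OFF y = (start y)%:Z.
Proof.
move=> m0 mO yt; rewrite /offsets.
(* Cell [y] changes only in the outer pass with counter [y]. *)
have inner i m' : eqoff [:: LL; JJ; OFF] m m' -> m' LL 0 = i%:Z -> (i <= t)%N ->
    denote (CFor JJ tE (CAssign OFF (var LL)
      (Get OFF (var LL) +e kE (var JJ) *e (var JJ +e Cst 1 <=e var LL)))) m' OFF y =
    m' OFF y + if i == y then (start y)%:Z else 0.
  move=> off mL it; have m'0 : m' 0%N =1 inp by move=> x; rewrite off ?m0.
  have tr : trips m' tE = t by rewrite /trips /= m'0 inp_t.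
  pose h (j : nat) : int := if i == y then if (j < y)%N then (k j)%:Z else 0 else 0.
  rewrite (@for_sum _ _ _ _ _ _ h) //; last first.
    move=> j m2; rewrite tr => jt off2 mJ.
    rewrite [denote _ _]/=.
    have mL2 : m2 LL 0 = i%:Z by rewrite off2.
    have m20 : m2 0%N =1 inp by move=> x; rewrite off2 ?m'0.
    rewrite /= /update eqxx /= mL2 mJ m20 inp_k // eqz_nat /h eq_sym.
    case: eqP => [->|]; last by rewrite addr0.
    by rewrite -PoszD addn1 lez_nat; case: (j < y)%N; rewrite ?mulr1 ?mulr0.
  rewrite tr /h; case: eqP => // _; last by rewrite big1.
  congr (_ + _); rewrite -big_mkcond /= -(big_ord_widen t (fun j => (k j)%:Z)) //.
  by rewrite /start (big_morph Posz PoszD erefl).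
have tr : trips m (tE +e Cst 1) = t.+1 by rewrite /trips /= m0 inp_t -PoszD addn1.
rewrite (@for_sum _ _ _ _ _ _ (fun i => if i == y then (start y)%:Z else 0)) //.
  by rewrite tr mO add0r -big_mkcond (big_ord1_eq _ (fun=> (start y)%:Z)) ltnS yt.
move=> i m'; rewrite tr ltnS => it off mL; exact: inner.
Qed.

Definition base (D : int) (m : memory) : Prop :=
  [/\ m 0%N =1 inp, forall l, (l <= t)%N -> m OFF l = (start l)%:Z & m DEN 0 = D].

Lemma base_eqoff W D m m' : eqoff W m m' -> all (fun a => a \notin W) [:: 0; OFF; DEN]%N ->
  base D m -> base D m'.
Proof.
by move=> h /and4P[W0 WO WD _] [b0 bO bD]; split; rewrite ?h // => l lt; rewrite h ?bO.
Qed.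

Definition common_denominator (D : int) : Prop :=
  0 < D /\ forall i j c, (i < n)%N -> (j < t)%N -> (c < k j)%N ->
    (denq (v i j c) %| D)%Z.

Lemma eval_sizeE D m : base D m -> eval m sizeE = size%:Z.
Proof. by case=> b0 bO _; rewrite /= b0 inp_t bO. Qed.

Lemma trips_agentsE D m : (0 < size)%N -> base D m -> trips m agentsE = n.
Proof.
move=> size0 bm; rewrite /trips -[eval _ _]/(eval m nE * (if 1 <= eval m sizeE then 1 else 0)).
rewrite (eval_sizeE bm) lez_nat size0 mulr1.
by case: bm => b0 _ _; rewrite /= b0 inp_n.
Qed.

Lemma denote_denominators m : m 0%N =1 inp -> (forall l, (l <= t)%N -> m OFF l = (start l)%:Z) ->
  exists2 D, common_denominator D & base D (denote denominators m).
Proof.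
move=> m0 mO; pose N := (n * size)%N; pose d x := inp (2 + t + 2 * x + 1)%N%:Z.
(* The loop counts down, so the denominators with index at least [x0] have been multiplied in. *)
pose Q x0 m' := exists2 D, base D m' & 0 < D /\
  forall x, (x0 <= x)%N -> (x < N)%N -> (d x %| D)%Z.
suff [D bD [D0 dvd]] : Q 0%N (denote denominators m).
  exists D => //; split=> // i j c lti jt ck; rewrite -inp_den //.
  apply: dvd => //; have := start_lt jt ck; rewrite /N; nia.
rewrite /denominators denote_seq [denote (assign _ _) m]/=.
set m1 := update m DEN 0 1.
have b1 : base 1 m1 by [].
have tr : trips m1 (nE *e sizeE) = N.
  by rewrite /trips [eval _ _]/=; case: (b1) => b0 bO _; rewrite b0 b0 inp_n inp_t bO.
apply: for_ind.
  exists 1; first by apply: base_eqoff b1; [apply: (@eqoff_update [:: CC]) |].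
  by split=> // x; rewrite tr; lia.
move=> x m'; rewrite tr => xN [D [b0 bO bD] [D0 dvd]].
have dE : eval (update m' CC 0 x) (Get 0 (Cst 2 +e tE +e Cst 2 *e var CC +e Cst 1)) = d x.
  by rewrite /= /update /= !b0 inp_t /d; congr inp; lia.
have d0 : 0 < d x by apply: inp_den_gt0.
exists (D * d x).
  split=> //; rewrite [denote _ _]/= update_eq; congr (_ * _) => //.
split=> [|x']; first exact: mulr_gt0.
rewrite leq_eqVlt => /orP[/eqP <- _|x'x x'N]; first exact: dvdz_mull.
by apply: dvdz_mulr; apply: dvd.
Qed.

Definition zvalue (D : int) (i j c : nat) : int :=
  numq (v i j c) * (D %/ denq (v i j c))%Z.

Lemma zvalueE D i j c : common_denominator D -> (i < n)%N -> (j < t)%N -> (c < k j)%N ->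
  (zvalue D i j c)%:~R = D%:~R * v i j c :> rat.
Proof.
case=> _ dvd lti jt ck; rewrite /zvalue intrM numqE.
have := divzK (dvd i j c lti jt ck); set q := (D %/ _)%Z => <-.
by rewrite intrM; ring.
Qed.

Section Offer.
Variables (D : int) (r l i : nat) (u : nat -> nat).
Hypothesis D_common : common_denominator D.
Hypothesis lt_i : (i < n)%N.
Hypothesis u_le : forall j, (j < t)%N -> (u j <= k j)%N.
Let rem := remaining k u.
Let b := bundle t r rem l.

Definition offering (m : memory) : Prop :=
  [/\ base D m, m RR 0 = r%:Z, m LL 0 = l%:Z & m II 0 = i%:Z].

Definition used (m : memory) : Prop := forall j, (j < t)%N -> m USED j = (u j)%:Z.

Lemma offering_eqoff W m m' : eqoff W m m' ->
  all (fun a => a \notin W) [:: 0; OFF; DEN; RR; LL; II]%N -> offering m -> offering m'.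
Proof.
move=> h /and5P[W0 WO WD WR /and3P[WL WI _]] [bm mR mL mI].
by split; rewrite ?(h RR) ?(h LL) ?(h II) //; apply: base_eqoff h _ bm; apply/and4P.
Qed.

Lemma used_eqoff W m m' : eqoff W m m' -> USED \notin W -> used m -> used m'.
Proof. by move=> h WU um j jt; rewrite h ?um. Qed.

Lemma eval_remE m (j : nat) : offering m -> m USED j = (u j)%:Z -> m JJ 0 = j%:Z -> (j < t)%N ->
  eval m remE = (rem j)%:Z.
Proof.
case=> -[b0 _ _] _ _ _ mU mJ jt.
by rewrite /= mJ b0 inp_k // mU /rem /remaining subzn ?u_le.
Qed.

Lemma eval_bundleE m (j : nat) : offering m -> m USED j = (u j)%:Z -> m JJ 0 = j%:Z -> (j < t)%N ->
  eval m bundleE = (b j)%:Z.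
Proof.
move=> om mU mJ jt; have rE := eval_remE om mU mJ jt.
case: om => -[b0 _ _] mR mL mI.
have tE' : eval m tE = t by rewrite /= b0 inp_t.
have lE : eval m (var LL) = l by [].
have RE : eval m (var RR) = r by [].
have sE : eval m singleE = (t.+1 + j)%N by rewrite /= b0 inp_t mJ; lia.
have jE : eval m (var JJ) = j by [].
have leqE x y : (if x%:Z <= y%:Z then 1 else 0 : int) = (x <= y)%N%:Z.
  by rewrite lez_nat; case: leqP.
rewrite -[eval m bundleE]/((if eval m (var LL) <= eval m singleE then 1 else 0)
  * (if eval m singleE <= eval m (var LL) then 1 else 0)
  * (if 1 <= eval m remE then 1 else 0)
  + (if eval m (var LL) <= eval m tE then 1 else 0)
  * ((eval m remE + eval m (var RR) * (if eval m (var LL) <= eval m (var JJ) then 1 else 0))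
     %/ (eval m (var RR) + 1))%Z).
rewrite tE' lE RE sE jE rE !leqE -!PoszM -!PoszD divz_nat -PoszM -PoszD.
by rewrite /b /bundle addn1.
Qed.

Lemma eval_valueE m (j : nat) pe (p : nat) : offering m -> m JJ 0 = j%:Z -> (j < t)%N ->
  eval m pe = p%:Z -> (p < k j)%N -> eval m (valueE pe) = zvalue D i j p.
Proof.
move=> om mJ jt pE pk; case: om => bm _ _ mI; have sE := eval_sizeE bm.
case: bm => b0 bO bD.
have aE : eval m (addrE pe) = (2 + t + 2 * (i * size + (start j + p)))%N%:Z.
  rewrite -[eval m (addrE pe)]/(2 + eval m tE + 2 * (eval m (var II) * eval m sizeE
    + (m OFF (m JJ 0) + eval m pe))).
  have -> : eval m (var II) = i by [].
  rewrite sE pE mJ bO 1?ltnW // /= b0 inp_t; lia.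
rewrite -[eval m (valueE pe)]/(m 0%N (eval m (addrE pe)) *
  (m DEN 0 %/ m 0%N (eval m (addrE pe) + 1))%Z).
by rewrite aE !b0 bD inp_num // -PoszD inp_den.
Qed.

Lemma denote_evaluate m : offering m -> used m ->
  let m' := denote evaluate m in
  m' FAIR 0 = m FAIR 0 + \sum_(j < t) \sum_(c < rem j) zvalue D i j (c %/ r.+1)%N /\
  m' WORTH 0 = m WORTH 0 + \sum_(j < t) \sum_(c < b j) zvalue D i j c.
Proof.
move=> om um m'.
have tr m2 : offering m2 -> trips m2 tE = t.
  by case=> -[b0 _ _] _ _ _; rewrite /trips /= b0 inp_t.
have trs m2 : offering m2 -> trips m2 sizeE = size.
  by case=> b2 _ _ _; rewrite /trips (eval_sizeE b2).
have trunc (a : nat) (h : nat -> int) : (a <= size)%N ->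
    \sum_(c < size) (if (c < a)%N then h c else 0) = \sum_(c < a) h c.
  by move=> le; rewrite -big_mkcond /= -big_ord_widen.
(* Beyond the cutoff the entries read need not belong to type [j]; the factor 0 discards them. *)
have evE m2 (j c a p : nat) pe ae : offering m2 -> m2 JJ 0 = j%:Z -> (j < t)%N ->
    m2 CC 0 = c%:Z -> eval m2 ae = a%:Z -> eval m2 pe = p%:Z -> (c < a -> p < k j)%N ->
    eval m2 (valueE pe *e (var CC +e Cst 1 <=e ae)) = if (c < a)%N then zvalue D i j p else 0.
  move=> om2 mJ jt mC aE pE pk; rewrite -[LHS]/(eval m2 (valueE pe) *
    (if eval m2 (var CC) + 1 <= eval m2 ae then 1 else 0)).
  have -> : eval m2 (var CC) = c by [].
  rewrite aE -PoszD addn1 lez_nat; case: ifP => ca; last by rewrite mulr0.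
  by rewrite mulr1 (eval_valueE om2 mJ jt pE) ?pk.
have quoE m2 (c : nat) : offering m2 -> m2 CC 0 = c%:Z ->
    eval m2 (var CC /e (var RR +e Cst 1)) = (c %/ r.+1)%N%:Z.
  by case=> _ mR _ _ mC; rewrite /= mC mR -PoszD addn1 divz_nat.
have rem_le j : (j < t)%N -> (rem j <= k j)%N by move=> jt; apply: leq_subr.
have b_le j : (j < t)%N -> (b j <= k j)%N.
  by move=> jt; apply: leq_trans (bundle_le _ _ _ _ _) (rem_le j jt).
split.
- rewrite /m' /evaluate (@for_sum _ _ _ _ _ _
    (fun j => \sum_(c < rem j) zvalue D i j (c %/ r.+1)%N)) // ?tr //.
  move=> j m1 jt off1 mJ; have om1 := offering_eqoff off1 isT om.
  have um1 := used_eqoff off1 isT um.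
  rewrite (@for_sum _ _ _ _ _ _
    (fun c => if (c < rem j)%N then zvalue D i j (c %/ r.+1)%N else 0)) // ?trs //.
    by rewrite (trunc _ (fun c => zvalue D i j (c %/ r.+1)%N)) // (leq_trans (rem_le j jt)) ?(k_le_size k).
  move=> c m2 cs off2 mC; have om2 := offering_eqoff off2 isT om1.
  have um2 := used_eqoff off2 isT um1.
  have mJ2 : m2 JJ 0 = j by rewrite off2.
  rewrite denote_seq; set cw := assign WORTH _.
  rewrite (denote_frame cw _ FAIR) // [LHS]update_eq.
  rewrite eval_add; congr (_ + _).
  apply: (evE _ _ _ _ _ _ _ om2 mJ2 jt mC (eval_remE om2 (um2 j jt) mJ2 jt)
    (quoE _ _ om2 mC)).
  by move=> cr; apply: leq_ltn_trans (leq_div _ _) (leq_trans cr (rem_le j jt)).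
- rewrite /m' /evaluate (@for_sum _ _ _ _ _ _
    (fun j => \sum_(c < b j) zvalue D i j c)) // ?tr //.
  move=> j m1 jt off1 mJ; have om1 := offering_eqoff off1 isT om.
  have um1 := used_eqoff off1 isT um.
  rewrite (@for_sum _ _ _ _ _ _
    (fun c => if (c < b j)%N then zvalue D i j c else 0)) // ?trs //.
    by rewrite (trunc _ (zvalue D i j)) // (leq_trans (b_le j jt)) ?(k_le_size k).
  move=> c m2 cs off2 mC; rewrite denote_seq; set m3 := denote (assign FAIR _) m2.
  have off3 : eqoff [:: FAIR] m2 m3 by exact: (denote_frame (assign FAIR _)).
  have om3 := offering_eqoff off3 isT (offering_eqoff off2 isT om1).
  have um3 := used_eqoff off3 isT (used_eqoff off2 isT um1).
  have mJ3 : m3 JJ 0 = j by rewrite off3 // off2.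
  rewrite [LHS]update_eq eval_add -(off3 WORTH) //; congr (_ + _).
  have mC3 : m3 CC 0 = c by rewrite off3.
  apply: (evE _ _ _ _ _ _ _ om3 mJ3 jt mC3 (eval_bundleE om3 (um3 j jt) mJ3 jt)) => //.
  by move=> cb; apply: leq_trans (b_le j jt).
Qed.

(** Both sides of the integer comparison are [D] times the rational ones, and [D > 0] cancels. *)
Lemma accepts_evaluate m : offering m -> used m -> m FAIR 0 = 0 -> m WORTH 0 = 0 ->
  let m' := denote evaluate m in
  (m' FAIR 0 <= 2 * (r%:Z + 1) * m' WORTH 0) = accepts t v i r rem l.
Proof.
move=> om um F0 W0 m'; have [] := denote_evaluate om um.
rewrite -/m' F0 W0 !add0r => -> ->.
rewrite -(ler_int rat) !intrM rmorphD /= !rmorph_sum /=.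
have D0 : 0 < D%:~R :> rat by rewrite ltr0z; case: D_common.
have rem_le j : (j < t)%N -> (rem j <= k j)%N by move=> jt; apply: leq_subr.
have -> : \sum_(j < t) (\sum_(c < rem j) zvalue D i j (c %/ r.+1)%N)%:~R
    = D%:~R * fair t v i r.+1 rem.
  rewrite /fair mulr_sumr; apply: eq_bigr => j _.
  rewrite rmorph_sum /spread mulr_sumr; apply: eq_bigr => c _ /=.
  rewrite zvalueE // (leq_ltn_trans (leq_div _ _)) //.
  exact: leq_trans (ltn_ord c) (rem_le j (ltn_ord j)).
have -> : \sum_(j < t) (\sum_(c < b j) zvalue D i j c)%:~R = D%:~R * worth t v i b.
  rewrite /worth mulr_sumr; apply: eq_bigr => j _.
  rewrite rmorph_sum /upto mulr_sumr; apply: eq_bigr => c _ /=.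
  rewrite zvalueE //; apply: leq_trans (ltn_ord c) _.
  by apply: leq_trans (bundle_le _ _ _ _ _) (rem_le j (ltn_ord j)).
rewrite mulrCA ler_pM2l // /accepts -/b -[r.+1%:R]natr1.
by rewrite intrD.
Qed.

Lemma denote_give m : offering m -> used m ->
  let m' := denote give m in
  (forall j, (j < t)%N -> m' USED j = (u j + b j)%N%:Z) /\
  forall j c, (j < t)%N -> (c < k j)%N -> m' OWN (start j + c)%N%:Z =
    if (u j <= c < u j + b j)%N then i%:Z else m OWN (start j + c)%N%:Z.
Proof.
move=> om um m'.
have tr m2 : offering m2 -> trips m2 tE = t.
  by case=> -[b0 _ _] _ _ _; rewrite /trips /= b0 inp_t.
have trs m2 : offering m2 -> trips m2 sizeE = size.
  by case=> b2 _ _ _; rewrite /trips (eval_sizeE b2).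
have b_le j : (j < t)%N -> (u j + b j <= k j)%N.
  move=> jt; have := bundle_le t r rem l j; have := u_le jt.
  by rewrite -/b /rem /remaining; lia.
(* Types are served downwards: those from [j0] on have received their new owners and counts. *)
pose Q j0 m2 := [/\ eqoff (writes give) m m2,
  forall j, (j < t)%N -> m2 USED j = (if (j0 <= j)%N then (u j + b j)%N else u j)%:Z &
  forall j c, (j < t)%N -> (c < k j)%N -> m2 OWN (start j + c)%N%:Z =
    if (j0 <= j)%N && (u j <= c < u j + b j)%N then i%:Z else m OWN (start j + c)%N%:Z].
suff : Q 0%N m' by case.
apply: for_ind.
  split=> [|j jt|j c jt ck]; first exact: eqoff_update.
    by rewrite /update /= tr // leqNgt jt um.
  by rewrite /update /= tr // leqNgt jt.
move=> j0 m2; rewrite tr // => jt [off U O]; rewrite denote_seq.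
set m3 := update m2 JJ 0 j0; set cc := CFor CC sizeE _.
have off3 : eqoff (writes give) m m3 by apply: eqoff_trans off (eqoff_update _ _ _ _).
have om3 := offering_eqoff off3 isT om.
have mJ3 : m3 JJ 0 = j0 by rewrite /m3 update_eq.
have U3 : m3 USED j0 = u j0 by rewrite /m3 /update /= U // ltnn.
have [off4 O4] : eqoff [:: CC; OWN] m3 (denote cc m3) /\ forall y : nat,
    denote cc m3 OWN y = if (start j0 + u j0 <= y < start j0 + u j0 + b j0)%N then i%:Z
      else m3 OWN y.
  pose Q' (c0 : nat) m4 := eqoff [:: CC; OWN] m3 m4 /\ forall y : nat, m4 OWN y =
    if (start j0 + u j0 + c0 <= y < start j0 + u j0 + b j0)%N then i%:Z else m3 OWN y.
  suff : Q' 0%N (denote cc m3) by rewrite /Q' addn0.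
  apply: for_ind.
    split=> [|y]; first exact: eqoff_update.
    rewrite /update /= trs //; have -> // : (start j0 + u j0 + size <= y < start j0 + u j0 + b j0)%N = false.
    have := b_le j0 jt; have := k_le_size k jt; lia.
  move=> c m4; rewrite trs // => cs [off4 O4].
  set m5 := update m4 CC 0 c.
  have off5 : eqoff [:: CC; OWN] m3 m5 by apply: eqoff_trans off4 (eqoff_update _ _ _ _).
  have om5 := offering_eqoff off5 isT om3.
  have mJ5 : m5 JJ 0 = j0 by rewrite off5.
  have mC5 : m5 CC 0 = c by rewrite /m5 update_eq.
  have U5 : m5 USED j0 = u j0 by rewrite off5.
  have bE : eval m5 bundleE = b j0 by apply: eval_bundleE.
  have stE : m5 OFF (m5 JJ 0) = (start j0)%:Z.
    by rewrite mJ5; case: om5 => -[_ bO _] _ _ _; apply/bO/ltnW.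
  have -> : denote (CIf (var CC +e Cst 1 <=e bundleE)
      (CAssign OWN (Get OFF (var JJ) +e Get USED (var JJ) +e var CC) (var II))) m5
    = if (c < b j0)%N then update m5 OWN (start j0 + u j0 + c)%N i else m5.
    rewrite -[LHS]/(if (if m5 CC 0 + 1 <= eval m5 bundleE then 1 else 0) != 0 then
      update m5 OWN (m5 OFF (m5 JJ 0) + m5 USED (m5 JJ 0) + m5 CC 0) (m5 II 0) else m5).
    rewrite bE stE mJ5 U5 mC5.
    rewrite -!PoszD addn1 lez_nat; case: om5 => _ _ _ ->.
    by case: (c < b j0)%N.
  have O5 (y : nat) : m5 OWN y = m4 OWN y by [].
  case: ifP => cb; (split; last move=> y).
  - by apply: eqoff_trans off5 (eqoff_update _ _ _ _).
  - rewrite /update eqxx /= eqz_nat O5 O4; case: eqP => [->|yc].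
      by rewrite leqnn ltn_add2l cb.
    congr (if _ then _ else _); lia.
  - exact: off5.
  - by rewrite O5 O4; congr (if _ then _ else _); lia.
set m4 := denote cc m3 in off4 O4 *.
have om4 := offering_eqoff off4 isT om3.
have mJ4 : m4 JJ 0 = j0 by rewrite off4.
have U4 : m4 USED j0 = u j0 by rewrite off4.
have -> : denote (CAssign USED (var JJ) (Get USED (var JJ) +e bundleE)) m4
   = update m4 USED j0 (u j0 + b j0)%N.
  rewrite -[LHS]/(update m4 USED (m4 JJ 0) (m4 USED (m4 JJ 0) + eval m4 bundleE)).
  by rewrite mJ4 U4 (eval_bundleE om4 U4 mJ4 jt).
split=> [|j jt'|j c jt' ck].
- apply: eqoff_trans off3 (eqoff_trans (eqoff_sub _ off4) (eqoff_update _ _ _ _)) => //.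
  by move=> a; rewrite !inE => /orP[] /eqP ->.
- rewrite /update eqxx /= eqz_nat; case: (ltngtP j j0) => [lt|gt|->] //=.
  + by rewrite off4 // /m3 /update /= U // (leqNgt j0.+1) ltnS (ltnW lt).
  + by rewrite off4 // /m3 /update /= U // gt.
rewrite -[update _ _ _ _ OWN]/(m4 OWN) O4 -[m3 OWN]/(m2 OWN) O //.
have [jj|jj] := eqVneq j j0.
  rewrite jj ltnn leqnn /=; congr (if _ then _ else _).
  by rewrite -addnA !leq_add2l ltn_add2l.
(* The segments of different types in [OWN] are disjoint. *)
have -> : (start j0 + u j0 <= start j + c < start j0 + u j0 + b j0)%N = false.
  apply/negP => /andP[h1 h2]; case/eqP: jj.
  apply: (@start_disjoint t k j j0 c (start j + c - start j0)) => //; last lia.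
  by have := b_le j0 jt; lia.
by rewrite (leq_eqVlt j0) eq_sym (negPf jj).
Qed.

End Offer.

(** * The invariant along the loops of the program *)

Section Rounds.
Variables (D : int) (z : nat -> rat).
Hypothesis D_common : common_denominator D.
Hypothesis v_ge0 : forall i j c, 0 <= v i j c.
Hypothesis v_noninc : forall i j c d, (c <= d)%N -> v i j d <= v i j c.
Hypothesis z_le : forall u r i, (0 < r)%N -> (i < n)%N ->
  (forall j, (j < t)%N -> (u j <= k j)%N) -> (\sum_(j < t) u j + r <= n)%N ->
  z i * r%:R <= fair t v i r (remaining k u).

Definition state (r : nat) (u : nat -> nat) (m : memory) : Prop :=
  used u m /\ fair_state n t k v z r u (fun i => 0 < m DONE i)
    (fun j c => m OWN (start j + c)%N).

Lemma state_eqoff W r u m m' : eqoff W m m' ->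
  all (fun a => a \notin W) [:: USED; DONE; OWN] -> state r u m -> state r u m'.
Proof.
move=> h /and4P[WU WD WO _] [um st]; split; first exact: used_eqoff h WU um.
by rewrite (h DONE) ?(h OWN).
Qed.

Section Round.
Variables (r : nat) (u : nat -> nat) (m0 : memory).
Hypothesis st0 : state r.+1 u m0.
Let u_le : forall j, (j < t)%N -> (u j <= k j)%N.
Proof. by case: st0 => _ []. Qed.

(* All offers that precede the offer of bundle [l] to agent [i] have been made. *)
Definition offered (l i : nat) (m : memory) : Prop :=
  [/\ base D m, m RR 0 = r%:Z &
   [/\ m FOUND 0 = 0, m USED = m0 USED, m DONE = m0 DONE, m OWN = m0 OWN &
       forall l' i', (i' < n)%N -> m0 DONE i' <= 0 -> (l' <= 2 * t)%N ->
         (l < l')%N \/ l' = l /\ (i <= i')%N ->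
         ~~ accepts t v i' r (remaining k u) l']
   \/ m FOUND 0 = 1 /\ exists u', state r u' m].

(** After an acceptance only scratch arrays change. The first acceptance is an instance of
    [fair_state_step], whose rejection hypothesis is what [offered] has recorded. *)
Lemma offer_step l i m : (i < n)%N -> (l <= 2 * t)%N -> m LL 0 = l%:Z -> m II 0 = i%:Z ->
  offered l i.+1 m -> offered l i (denote offer m) /\ denote offer m LL 0 = l%:Z.
Proof.
move=> lt_i l_le mL mI [bm mR found]; split; last by rewrite (denote_frame offer).
have om : offering D r l i m by [].
rewrite /offer denote_seq; set m1 := denote (_ ;; _) m.
have off1 : eqoff [:: FAIR; WORTH; JJ; CC] m m1.
  move=> a aW; apply: (denote_frame (assign FAIR (Cst 0) ;; assign WORTH (Cst 0) ;; evaluate)).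
  by apply: contra aW; rewrite !inE; do ![case/orP|by move=> ->; rewrite ?orbT].
have om1 := offering_eqoff off1 isT om; case: (om1) => bm1 mR1 mL1 mI1.
set c2 := (assign FOUND _ ;; _).
have condE : eval m1 ((var FOUND <=e Cst 0) *e (Get DONE (var II) <=e Cst 0) *e
    (var FAIR <=e Cst 2 *e (var RR +e Cst 1) *e var WORTH)) != 0
  = [&& m1 FOUND 0 <= 0, m1 DONE i <= 0 & m1 FAIR 0 <= 2 * (r%:Z + 1) * m1 WORTH 0].
  rewrite /= mI1 mR1; do 3![case: ifP => _ //=]; by rewrite ?mulr0.
rewrite denote_if condE.
case: found => [[F0 mU mD mO rej]|[F1 [u' stu']]]; last first.
  rewrite (off1 FOUND) // F1 /=; split=> //; right; split; first by rewrite off1.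
  by exists u'; apply: state_eqoff off1 isT stu'.
have um : used u m by move=> j jt; rewrite mU; case: st0 => ->.
have accE : (m1 FAIR 0 <= 2 * (r%:Z + 1) * m1 WORTH 0) = accepts t v i r (remaining k u) l.
  pose ma := denote (assign FAIR (Cst 0) ;; assign WORTH (Cst 0)) m.
  have offa : eqoff [:: FAIR; WORTH] m ma := denote_frame (assign FAIR _ ;; assign WORTH _) m.
  have oma := offering_eqoff offa isT om; have uma := used_eqoff offa isT um.
  exact: (accepts_evaluate D_common lt_i u_le oma uma).
rewrite accE (off1 FOUND) // F0 (off1 DONE) // mD lexx andTb.
have rejected : ~~ ((m0 DONE i <= 0) && accepts t v i r (remaining k u) l) ->
    offered l i m1.
  move=> nacc; split=> //; left; split; rewrite ?off1 // => l' i' lt' act' le' [ll|[-> ii]].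
    by apply: rej => //; left.
  move: ii; rewrite leq_eqVlt => /orP[/eqP ii|ii]; last by apply: rej => //; right.
  by move: nacc; rewrite ii act'.
case: ifP => [/andP[act acc]|/negbT]; last exact: rejected.
set m2 := denote (assign FOUND (Cst 1) ;; CAssign DONE (var II) (Cst 1)) m1.
have -> : denote c2 m1 = denote give m2 by [].
have off2 : eqoff [:: FOUND; DONE] m1 m2 :=
  denote_frame (assign FOUND _ ;; CAssign DONE _ _) m1.
have om2 := offering_eqoff off2 isT om1.
have um2 : used u m2 by apply: used_eqoff off2 isT (used_eqoff off1 isT um).
have [U O] := denote_give lt_i u_le om2 um2.
have off3 : eqoff (writes give) m2 (denote give m2) := denote_frame give m2.
have [bm3 mR3 _ _] := offering_eqoff off3 isT om2.
split=> //; right; split; first by rewrite off3.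
exists (fun j => u j + bundle t r (remaining k u) l j)%N; split=> //.
have [_ fst0] := st0.
apply: (fair_state_step v_ge0 v_noninc z_le fst0 lt_i _ acc) => //.
- by rewrite -leNgt.
- move=> i' l' lt' act' ll le'; apply: rej => //; first by rewrite leNgt.
  by left.
- move=> i' lt'; rewrite off3 // /m2 /= /update /= mI1 eqz_nat.
  by case: eqP => //= _; rewrite (off1 DONE) // mD.
- by move=> j c jt ck; rewrite O // (off2 OWN) // (off1 OWN) // mO.
Qed.

Lemma denote_round : (0 < size)%N -> base D m0 -> m0 RR 0 = r%:Z ->
  base D (denote round m0) /\ exists u', state r u' (denote round m0).
Proof.
move=> size0 b0 mR0; rewrite /round denote_seq; set m1 := denote (assign FOUND _) m0.
have off1 : eqoff [:: FOUND] m0 m1 := denote_frame (assign FOUND _) m0.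
have offered_eqoff W l i m m' : eqoff W m m' ->
    all (fun a => a \notin W) [:: 0; OFF; DEN; RR; FOUND; USED; DONE; OWN]%N ->
    offered l i m -> offered l i m'.
  move=> h; rewrite -[[:: _, _, _, _ & _]]/([:: 0; OFF; DEN]%N ++ [:: RR; FOUND] ++ [:: USED; DONE; OWN]%N).
  rewrite 2!all_cat => /and3P[W1 /and3P[WR WF _] W2] [bm mR fo].
  split; rewrite ?(h RR) //; first exact: base_eqoff h W1 bm.
  case: fo => [[F0 mU mD mO rej]|[F1 [u' st']]]; [left|right].
    by move: W2 => /and4P[WU WD WO _]; split; rewrite ?(h FOUND) ?(h USED) ?(h DONE) ?(h OWN).
  by rewrite (h FOUND) //; split=> //; exists u'; apply: state_eqoff h W2 st'.
have updW m x y : eqoff [:: x] m (update m x 0 y).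
  by apply: eqoff_update; rewrite inE.
have b1 : base D m1 by apply: base_eqoff off1 isT b0.
have : offered 0 0 (denote (CFor LL (Cst 2 *e tE +e Cst 1) (CFor II agentsE offer)) m1).
  have tr : trips m1 (Cst 2 *e tE +e Cst 1) = (2 * t).+1.
    by case: b1 => b0' _ _; rewrite /trips /= b0' inp_t -PoszM -PoszD addn1.
  apply: (@for_ind _ _ _ _ (fun l m => offered l 0 m)).
    rewrite tr; apply: (offered_eqoff _ _ _ _ _ (updW _ LL _) isT); split; rewrite ?(off1 RR) //.
    left; split; rewrite ?(off1 USED) ?(off1 DONE) ?(off1 OWN) // => l' i' _ _ le'.
    by case=> [|[]]; lia.
  move=> l m; rewrite tr ltnS => l_le ofm.
  set m2 := update m LL 0 l; have of2 : offered l.+1 0 m2 := offered_eqoff _ _ _ _ _ (updW m LL l) isT ofm.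
  have trn : trips m2 agentsE = n by case: of2 => b2 _ _; apply: trips_agentsE b2.
  suff [] : offered l 0 (denote (CFor II agentsE offer) m2) /\
    denote (CFor II agentsE offer) m2 LL 0 = l by [].
  (* Bundle [l.+1] offered down to agent 0 is the same as bundle [l] offered to nobody, that is,
     down to [n]. *)
  apply: (@for_ind _ _ _ _ (fun i m => offered l i m /\ m LL 0 = l)).
    split; last by rewrite (updW _ II) // /m2 update_eq.
    apply: (offered_eqoff _ _ _ _ _ (updW _ II _) isT); rewrite trn; case: (of2) => b2 mR2 fo.
    split=> //; case: fo => [[F0 mU mD mO rej]|]; [left|by right].
    split=> // l' i' lt' act' le' [ll|[_ le_n]]; last by lia.
    apply: rej => //; move: ll; rewrite leq_eqVlt => /orP[/eqP <-|ll]; [right|left] => //.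
  move=> i m3; rewrite trn => lt_i [of3 mL3].
  have mL4 : update m3 II 0 i LL 0 = l by rewrite (updW m3 II).
  have mI4 : update m3 II 0 i II 0 = i by rewrite update_eq.
  apply: (offer_step lt_i l_le mL4 mI4).
  exact: (offered_eqoff _ _ _ _ _ (updW _ II _) isT of3).
case=> b2 _ [[_ _ _ _ rej]|[_ st']]; last by split.
(* If nobody had accepted, an active agent would have rejected bundle 0. *)
have [i lt_i act] := fair_state_active (proj2 st0).
rewrite -leNgt in act.
have /negP[] := rej 0%N i lt_i act (leq0n _) (or_intror (conj erefl (leq0n _))).
exact: accepts_0.
Qed.

End Round.

Lemma denote_rounds m u : (0 < size)%N -> base D m -> state n u m ->
  exists u', state 0 u' (denote rounds m).
Proof.
move=> size0 bm st.
suff [] : base D (denote rounds m) /\ exists u', state 0 u' (denote rounds m) by [].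
have tr := trips_agentsE size0 bm.
have upd m' y : base D m' -> base D (update m' RR 0 y).
  by apply: base_eqoff (@eqoff_update [:: RR] _ _ _ _ _) isT; rewrite inE.
have upds m' r' u' y : state r' u' m' -> state r' u' (update m' RR 0 y).
  by apply: state_eqoff (@eqoff_update [:: RR] _ _ _ _ _) isT; rewrite inE.
apply: (@for_ind _ _ _ _ (fun r m => base D m /\ exists u', state r u' m)).
  by rewrite tr; split; [apply: upd | exists u; apply: upds].
move=> r m' _ [b' [u' st']]; by apply: (@denote_round r u') => //; apply: upds.
Qed.

End Rounds.

Definition algorithm := offsets ;; denominators ;; rounds.

Lemma denote_algorithm (z : nat -> rat) m :
  (0 < n)%N -> (0 < size)%N -> m 0%N =1 inp ->
  (forall a, a != 0%N -> m a =1 (fun=> 0)) ->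
  (forall i j c, 0 <= v i j c) ->
  (forall i j c d, (c <= d)%N -> v i j d <= v i j c) ->
  (forall u r i, (0 < r)%N -> (i < n)%N ->
    (forall j, (j < t)%N -> (u j <= k j)%N) -> (\sum_(j < t) u j + r <= n)%N ->
    z i * r%:R <= fair t v i r (remaining k u)) ->
  exists2 u, forall j, (j < t)%N -> (u j <= k j)%N & let m' := denote algorithm m in
  let own j c := m' OWN (start j + c)%N in
    (forall j c, (j < t)%N -> (c < k j)%N -> exists2 i, (i < n)%N & own j c = i%:Z) /\
    forall i, (i < n)%N -> z i <= 2 * worth t v i (owned u own i).
Proof.
move=> n0 size0 m0 mz v0 vn zl; rewrite /algorithm 2!denote_seq.
set m1 := denote offsets m; have off1 : eqoff [:: LL; JJ; OFF] m m1 := denote_frame offsets m.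
have m10 : m1 0%N =1 inp by move=> x; rewrite off1.
have m1O l : (l <= t)%N -> m1 OFF l = start l.
  by move=> lt; apply: denote_offsets => // x; apply: mz.
have [D D_common] := denote_denominators m10 m1O.
set m2 := denote denominators m1; move=> b2.
have off2 : eqoff [:: DEN; CC; DEN] m1 m2 := denote_frame denominators m1.
have z2 a : a \notin [:: 0; LL; JJ; OFF; DEN; CC]%N -> m2 a =1 fun=> 0.
  move=> aW x; rewrite off2; last by apply: contra aW; rewrite !inE; do ![case/orP]; move=> ->; rewrite ?orbT.
  rewrite off1; last by apply: contra aW; rewrite !inE; do ![case/orP]; move=> ->; rewrite ?orbT.
  by apply: mz; apply: contra aW; rewrite !inE => ->.
have st2 : state z n (fun=> 0%N) m2.
  split=> [j jt|]; first by rewrite z2.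
  split=> //.
  - rewrite -[RHS]card_ord -sum1_card; apply: eq_bigr => i _; by rewrite z2.
  - by move=> i _; rewrite z2.
  (* Cells of [OWN] start at 0, so copies never handed out belong to agent 0 and the allocation is
     complete. *)
  - by move=> j c _ _; exists 0%N; rewrite ?z2.
  - by left; rewrite big1.
have [u [_ [u_le cnt dn ow _]]] := denote_rounds D_common v0 vn zl size0 b2 st2.
exists u => //; split=> // i lt_i; apply: dn => //.
(* No active agent is left, so every agent is done. *)
have := cnt; rewrite (bigD1 (Ordinal lt_i)) //=; case: (0 < _) => //.
Qed.

End Correctness.

(** * Input format and running time *)

Section Polynomial.

Definition polynomial_fun (f : nat -> nat) : Prop :=
  exists q : {poly nat}, forall x, f x = q.[x].

Lemma polynomial_cst c : polynomial_fun (fun=> c).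
Proof. by exists c%:P => x; rewrite hornerC. Qed.

Lemma polynomial_id : polynomial_fun id.
Proof. by exists 'X => x; rewrite hornerX. Qed.

Lemma polynomial_add f g : polynomial_fun f -> polynomial_fun g ->
  polynomial_fun (fun x => f x + g x)%N.
Proof. by case=> p fp [q gq]; exists (p + q) => x; rewrite hornerD fp gq. Qed.

Lemma polynomial_mul f g : polynomial_fun f -> polynomial_fun g ->
  polynomial_fun (fun x => f x * g x)%N.
Proof. by case=> p fp [q gq]; exists (p * q) => x; rewrite hornerM fp gq. Qed.

Lemma polynomial_succ f : polynomial_fun f -> polynomial_fun (fun x => (f x).+1).
Proof.
move=> pf; have [q fq] := polynomial_add (polynomial_cst 1) pf.
by exists q => x; rewrite -fq add1n.
Qed.

Lemma polynomial_steps f c : polynomial_fun f -> polynomial_fun (fun x => steps (f x) c).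
Proof.
move=> pf; elim: c => [a e1 e2|c1 IH1 c2 IH2|e c IH|x e c IH] /=.
- exact: polynomial_cst.
- exact: polynomial_add.
- by do 2!apply: polynomial_succ.
- by do 2!apply: polynomial_succ; apply: polynomial_mul => //; do 2!apply: polynomial_succ.
Qed.

Lemma polynomial_unit_cost E f : polynomial_fun f ->
  polynomial_fun (fun x => unit_cost x E (f x)).
Proof.
move=> pf; apply: polynomial_succ; apply: polynomial_mul; first exact: polynomial_cst.
apply: polynomial_succ; apply: polynomial_mul; first exact: polynomial_cst.
by apply: polynomial_add => //; apply: polynomial_id.
Qed.

End Polynomial.

(** * Addresses of the input entries *)

Section Input.
Variable I : instance.
Let n := agents I.
Let t := types I.
Let k := ncopies I.
Let M := start k t.

Lemma shape_goods : 
  shape [seq [seq (Tagged (fun j : 'I_t => 'I_(copies j)) c : good I) | c <- enum 'I_(copies j)]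
     | j <- enum 'I_t] = [seq k j | j <- iota 0 t].
Proof.
rewrite -val_enum_ord /shape -!map_comp; apply: eq_map => j /=.
by rewrite size_map size_enum_ord /k ncopiesE.
Qed.

Lemma sumn_start l : sumn [seq k j | j <- iota 0 l] = start k l.
Proof. by rewrite sumnE big_map -{1}[l]subn0 -/(index_iota _ _) big_mkord. Qed.

Lemma size_goods : size (goods I) = M.
Proof.
by rewrite size_flatten shape_goods sumn_start.
Qed.

Lemma start_index (j : 'I_t) (c : nat) : 
  flatten_index [seq k j | j <- iota 0 t] j c = (start k j + c)%N.
Proof.
rewrite /flatten_index -map_take take_iota (minn_idPl (ltnW (ltn_ord j))).
by rewrite sumn_start.
Qed.

Lemma nth_goods x0 (j : 'I_t) (c : 'I_(copies j)) :
  nth x0 (goods I) (start k j + c) = Tagged (fun j : 'I_t => 'I_(copies j)) c.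
Proof.
rewrite -start_index /goods nth_flatten shape_goods.
have ck : (c < nth 0 [seq k j | j <- iota 0 t] j)%N.
  by rewrite (nth_map 0%N) ?size_iota // nth_iota // /k ncopiesE.
rewrite flatten_indexKl // flatten_indexKr //.
by rewrite (nth_map j) ?size_enum_ord // nth_ord_enum (nth_map c) ?size_enum_ord // nth_ord_enum.
Qed.

Lemma index_goods (j : 'I_t) (c : 'I_(copies j)) :
  index (Tagged (fun j : 'I_t => 'I_(copies j)) c : good I) (goods I) = (start k j + c)%N.
Proof.
rewrite -(nth_goods (Tagged _ c)) index_uniq ?uniq_goods // size_goods.
by apply: start_lt => //; rewrite /k ncopiesE.
Qed.

Let entry (p : 'I_n * good I) : seq int :=
  let q := value p.1 (tagged p.2) in [:: numq q; denq q].

Lemma inputE : input I = [:: n%:Z; t%:Z] ++ [seq (copies j)%:Z | j <- enum 'I_t] ++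
  flatten [seq entry p | p <- [seq (i, g) | i <- enum 'I_n, g <- goods I]].
Proof. by rewrite map_allpairs. Qed.

Lemma nth_pairs (i : 'I_n) (g : nat) x0 : (g < M)%N ->
  nth x0 [seq (i, g) | i <- enum 'I_n, g <- goods I] (i * M + g) = (i, nth x0.2 (goods I) g).
Proof.
move=> gM; have sh : shape [seq [seq (i, g) | g <- goods I] | i <- enum 'I_n] = nseq n M.
  rewrite /shape -map_comp (eq_map (g := fun=> M)) => [|i']; last by rewrite /= size_map size_goods.
  by rewrite -[X in nseq X](size_enum_ord n); elim: (enum 'I_n) => //= i' s ->.
have -> : (i * M + g = flatten_index (nseq n M) i g)%N.
  rewrite /flatten_index take_nseq; last exact: ltnW.
  by rewrite sumn_nseq [(i * _)%N]mulnC.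
have gn : (g < nth 0 (nseq n M) i)%N by rewrite nth_nseq ltn_ord.
rewrite nth_flatten sh flatten_indexKl // flatten_indexKr //.
by rewrite (nth_map i) ?size_enum_ord // nth_ord_enum (nth_map x0.2) ?size_goods.
Qed.

Lemma nth_entries (s : seq ('I_n * good I)) x0 (x b : nat) : (x < size s)%N -> (b < 2)%N ->
  nth 0 (flatten [seq entry p | p <- s]) (2 * x + b) = nth 0 (entry (nth x0 s x)) b.
Proof.
elim: s x => // p s IH [|x] lt b2; first by case: b b2 {IH} => [|[]].
by rewrite mulnS -addnA; apply: IH.
Qed.

Let inp := initial_memory I 0.

Lemma inp_n : inp 0 = n%:Z. Proof. by []. Qed.
Lemma inp_t : inp 1 = t%:Z. Proof. by []. Qed.

Lemma inp_k j : (j < t)%N -> inp (2 + j%:Z) = (k j)%:Z.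
Proof.
move=> jt; rewrite -[LHS]/(nth 0 (input I) j.+2) inputE /= nth_cat size_map size_enum_ord jt.
rewrite (nth_map (Ordinal jt)) ?size_enum_ord // -{2}[j]/(val (Ordinal jt)) nth_ord_enum.
by rewrite -ncopiesE.
Qed.

Lemma inp_entry (i : 'I_n) (g b : nat) x0 : (g < M)%N -> (b < 2)%N ->
  inp (2 + t + 2 * (i * M + g) + b)%N%:Z = nth 0 (entry (i, nth x0 (goods I) g)) b.
Proof.
move=> gM b2; rewrite -[LHS]/(nth 0 (input I) (2 + t + 2 * (i * M + g) + b)) inputE.
set ps := [seq (i, g) | i <- enum 'I_n, g <- goods I].
have -> : (2 + t + 2 * (i * M + g) + b = (t + (2 * (i * M + g) + b)).+2)%N by lia.
rewrite -[LHS]/(nth 0 ([seq (copies j)%:Z | j <- enum 'I_t] ++ flatten (map entry ps))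
  (t + (2 * (i * M + g) + b))).
rewrite nth_cat size_map size_enum_ord ltnNge leq_addr addKn {}/ps.
rewrite (nth_entries (i, x0)) // ?nth_pairs // size_allpairs size_enum_ord size_goods.
by have := ltn_ord i; nia.
Qed.

Lemma good_of_M g : (g < M)%N -> good I.
Proof. by rewrite -size_goods; case: (goods I). Qed.

Lemma inp_num i j c : (i < n)%N -> (j < t)%N -> (c < k j)%N ->
  inp (2 + t + 2 * (i * M + (start k j + c)))%N%:Z = numq (nvalue I i j c).
Proof.
move=> lti jt ck; have ck' : (c < copies (Ordinal jt))%N by rewrite -ncopiesE.
pose g := Tagged (fun j : 'I_t => 'I_(copies j)) (Ordinal ck').
rewrite -[X in inp X]/(Posz _) -[X in Posz X]addn0.
rewrite (inp_entry (Ordinal lti) g) //; last by apply: start_lt.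
by rewrite -[(start k j + c)%N]/(start k (Ordinal jt) + Ordinal ck')%N nth_goods /= -nvalueE.
Qed.

Lemma inp_den i j c : (i < n)%N -> (j < t)%N -> (c < k j)%N ->
  inp (2 + t + 2 * (i * M + (start k j + c)) + 1)%N%:Z = denq (nvalue I i j c).
Proof.
move=> lti jt ck; have ck' : (c < copies (Ordinal jt))%N by rewrite -ncopiesE.
pose g := Tagged (fun j : 'I_t => 'I_(copies j)) (Ordinal ck').
rewrite (inp_entry (Ordinal lti) g) //; last by apply: start_lt.
by rewrite -[(start k j + c)%N]/(start k (Ordinal jt) + Ordinal ck')%N nth_goods /= -nvalueE.
Qed.

Lemma inp_den_gt0 x : (x < n * M)%N -> 0 < inp (2 + t + 2 * x + 1)%N%:Z.
Proof.
move=> xlt; have M0 : (0 < M)%N by lia.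
have lti : (x %/ M < n)%N by rewrite ltn_divLR.
rewrite {1}(divn_eq x M) (inp_entry (Ordinal lti) (good_of_M M0)) ?ltn_mod //.
exact: denq_gt0.
Qed.

Lemma size_input : size (input I) = (2 + t + 2 * (n * M))%N.
Proof.
rewrite inputE !size_cat size_map size_enum_ord addnA; congr (_ + _)%N.
rewrite size_flatten /shape -map_comp (eq_map (g := fun=> 2%N)) //.
by rewrite sumnE big_map big_const_seq count_predT iter_addn_0 size_allpairs
  size_enum_ord size_goods.
Qed.

(** Every entry has at least one bit; this is what bounds the loops by the input size. *)
Lemma size_input_le : (2 + t + 2 * (n * M) <= input_size I)%N.
Proof. by rewrite -size_input -sum1_size leq_sum. Qed.

Lemma initial_bounded N : bounded (input_size I) N (initial_memory I).
Proof.
move=> [|a] [x|x] //=.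
have [lt|ge] := ltnP x (size (input I)); last by rewrite nth_default.
set y := nth _ _ _; apply: leq_trans (_ : 2 ^ bits y <= _)%N.
  by rewrite /bits ltnW // trunc_log_ltn.
rewrite leq_exp2l // /input_size (big_nth 0) big_mkord (bigD1 (Ordinal lt)) //=.
exact: leq_addr.
Qed.

End Input.

(** Every loop bound is at most [2 * s], and 150 bounds the weights of all expressions in the
    program. *)
Definition time_bound (s : nat) : nat :=
  let T := steps (2 * s) algorithm in (T * unit_cost s 150 (s + T * (150 * s)))%N.

Lemma polynomial_time_bound : polynomial_fun time_bound.
Proof.
have pT : polynomial_fun (fun s => steps (2 * s) algorithm).
  apply: polynomial_steps; apply: polynomial_mul; last exact: polynomial_id.
  exact: polynomial_cst.
apply: polynomial_mul => //; apply: polynomial_unit_cost.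
apply: polynomial_add; first exact: polynomial_id.
apply: polynomial_mul => //; apply: polynomial_mul; last exact: polynomial_id.
exact: polynomial_cst.
Qed.

(** * Time bound and allocation for a concrete instance *)

Section Correct.
Variable I : instance.
Let n := agents I.
Let t := types I.
Let k := ncopies I.
Let M := start k t.
Let m0 := initial_memory I.

(** The run is cut after [offsets]: later loop bounds read [OFF], which is fixed only from then
    on. *)
Lemma algorithm_time : exists2 time, (time <= time_bound (input_size I))%N &
  exec m0 (compile algorithm) time (denote algorithm m0).
Proof.
set s := input_size I; have s_ge : (2 + t + 2 * (n * M) <= s)%N := size_input_le I.
have s0 : (0 < s)%N by lia.
have [lin1 lin2] : linear_growth 150 offsets /\ linear_growth 150 (denominators ;; rounds).
  by split; vm_compute.
have inp0 : m0 0%N 0 = n by []. have inp1 : m0 0%N 1 = t by [].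
have r1 : runs_within s 150 (steps (2 * s) offsets) s m0 (compile offsets) (denote offsets m0).
  apply: (@compile_runs s 150 s0 isT _ (writes offsets)) => //; first exact: initial_bounded.
  split=> //; last by split=> //; rewrite /trips /= -/t; lia.
  by rewrite /trips /= -/t; lia.
have off1 : eqoff (writes offsets) m0 (denote offsets m0) := denote_frame offsets m0.
have r2 : runs_within s 150 (steps (2 * s) (denominators ;; rounds))
    (s + steps (2 * s) offsets * (150 * s)) (denote offsets m0)
    (compile (denominators ;; rounds)) (denote algorithm m0).
  case: r1 => time [_ b1 _].
  rewrite /algorithm denote_seq.
  apply: (@compile_runs s 150 s0 isT _ (writes (denominators ;; rounds))) => //.
  have t1 : denote offsets m0 0%N 1 = t by rewrite off1.
  have n1 : denote offsets m0 0%N 0 = n by rewrite off1.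
  have M1 : denote offsets m0 2%N t = M.
    by apply: (denote_offsets (inp := m0 0%N)) => // j jt; apply: inp_k.
  move: (denote offsets m0) t1 n1 M1 => m1 t1 n1 M1.
  have trt : (trips m1 tE <= 2 * s)%N by rewrite /trips /= t1; lia.
  have trM : (trips m1 sizeE <= 2 * s)%N.
    by rewrite /trips /= t1 M1; have := agents_gt0 I; rewrite -/n; nia.
  (* Without goods there are no trips; otherwise [n <= n * M], which the input size bounds. *)
  have trn : (trips m1 agentsE <= 2 * s)%N.
    by rewrite /trips /= n1 t1 M1 lez_nat; case: posnP => M0; rewrite ?mulr0 ?mulr1 //; nia.
  have trl : (trips m1 (Cst 2 *e tE +e Cst 1) <= 2 * s)%N.
    have -> : trips m1 (Cst 2 *e tE +e Cst 1) = (2 * t + 1)%N by rewrite /trips /= t1 -PoszM.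
    lia.
  have trd : (trips m1 (nE *e sizeE) <= 2 * s)%N.
    by rewrite /trips /= n1 t1 M1 -PoszM; lia.
  by do ![split].
have [time [ex _ le]] := runs_within_seq s0 (E := 150) isT r1 r2.
by exists time.
Qed.

Lemma size_card : M = #|good I|.
Proof.
rewrite -[M]size_goods -(card_uniqP (uniq_goods I)).
by apply: eq_card => g; rewrite mem_goods.
Qed.

Lemma price_vector_good (R : realType) (p : good I -> R) : price_vector p -> (0 < #|good I|)%N.
Proof.
case=> _ p1; rewrite lt0n; apply/negP => /eqP/card0_eq G0.
by move: p1; rewrite big_pred0 // => /eqP; rewrite eq_sym oner_eq0.
Qed.

(** There are no price vectors, and the infimum of the empty set is 0 by convention. *)
Lemma APS_no_good (R : realType) (i : 'I_n) (b : R) : #|good I| = 0%N -> APS i b = 0.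
Proof.
move=> G0; rewrite /APS; set V := (X in inf X); suff -> : V = classical_sets.set0 by rewrite inf0.
by apply/classical_sets.seteqP; split=> // x [p /price_vector_good]; rewrite G0.
Qed.

Definition allotted (m : memory) (i : 'I_n) : {set good I} :=
  [set g : good I | m 1%N (index g (goods I)) == i%:Z].

(** Only an inequality, since copies numbered from [u j] on may enlarge the allotment. *)
Lemma worth_allotted (m : memory) (u : nat -> nat) (i : 'I_n) :
  (forall j, (j < t)%N -> (u j <= k j)%N) ->
  worth t (nvalue I) i (owned u (fun j c => m 1%N (start k j + c)%N) i)
    <= valuation i (allotted m i).
Proof.
move=> u_le; rewrite valuationE; apply: ler_sum => j _.
apply: upto_le; first exact: nvalue_ge0.
pose P c := m 1%N (start k j + c)%N == i%:Z.
have -> : #|allotted m i :&: copies_of j| = (\sum_(c < copies j) P c)%N.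
  rewrite -card_type; apply: eq_card => -[j' c]; rewrite !inE /= andbC index_goods /P.
  by case: eqP => //= <-.
rewrite /owned (@big_ord_widen _ _ _ (u j) (copies j) (fun c => nat_of_bool (P c))).
  by rewrite [X in (X <= _)%N]big_mkcond; apply: leq_sum => c _; case: ifP.
by rewrite -ncopiesE u_le.
Qed.
End Correct.

Theorem mainTheorem2 (R : realType) :
  exists (P : program) (q : {poly nat}), forall I : instance,
  exists (time : nat) (m : memory) (A : 'I_(agents I) -> {set good I}),
    [/\ exec (initial_memory I) P time m,
        (time <= q.[input_size I])%N,
        outputs m A,
        is_allocation A &
        forall i : 'I_(agents I),
          1 / 2 * APS i (1 / (agents I)%:R : R) <= ratr (valuation i (A i))].
Proof.
have [q qE] := polynomial_time_bound.
exists (compile algorithm), q => I; have [time time_le ex] := algorithm_time I.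
set m := denote algorithm (initial_memory I) in ex.
exists time, m, (allotted m); rewrite qE in time_le.
have out : @outputs I m (allotted m) by move=> i g; rewrite inE.
have disj (i j : 'I_(agents I)) : i != j -> [disjoint allotted m i & allotted m j].
  move=> ij; rewrite disjoint_subset; apply/subsetP => g; rewrite /allotted !inE => /eqP ->.
  by rewrite eqz_nat.
have val0 (i : 'I_(agents I)) S : 0 <= valuation i S.
  by apply: sumr_ge0 => j _; apply: sumr_ge0 => c _; apply: value_ge0.
have [G0|G0] := posnP #|good I|.
  split=> //; first split=> //.
    by apply/setP => g; have := card0_eq G0 g; rewrite !inE.
  by move=> i; rewrite APS_no_good // mulr0 ler0q val0.
have [z [zE z_le]] := APS_fair R G0.
have M0 : (0 < start (ncopies I) (types I))%N by rewrite size_card.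
have mz a : a != 0%N -> initial_memory I a =1 fun=> 0 by case: a => // a _ [].
have [u u_le [own_lt z_worth]] := denote_algorithm (@inp_n I) (@inp_t I) (@inp_k I)
  (@inp_num I) (@inp_den I) (@inp_den_gt0 I) (agents_gt0 I) M0 (fun=> erefl)
  mz (@nvalue_ge0 I) (@nvalue_noninc I) z_le.
split=> //; first split=> //.
  apply/setP => g; rewrite inE; apply/bigcupP; case: g => j c.
  have [|i lt_i ownE] := own_lt j c (ltn_ord j); first by rewrite ncopiesE.
  by exists (Ordinal lt_i) => //; rewrite inE index_goods; apply/eqP.
move=> i; have le : z i <= 2 * valuation i (allotted m i).
  by apply: le_trans (z_worth i (ltn_ord i)) _; rewrite ler_wpM2l // worth_allotted.
by rewrite zE; move: le; rewrite -(ler_rat R) rmorphM /= rmorph_nat; lra.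
Qed.
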